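(* Let $d=1$ and $\Omega=[0,1]$. Let $P_X,P_Y$ be probability distributions on $\Omega$ with densities $f_X,f_Y$, and suppose there exist $0<a<b$ such that $a\le f_X,f_Y\le b$ on $\Omega$. Let $X_1,\dots,X_n$ be i.i.d. from $P_X$ and $Y_1,\dots,Y_n$ i.i.d. from $P_Y$, the two samples being independent, and let $T$ be the optimal transport map from $P_X$ to $P_Y$. Then there exists an $\epsilon$-central differentially private estimator $\hat T$ (built from the two samples) such that, if asymptotically $\epsilon=\Omega(n^{-1+\gamma})$ for some $\gamma>0$, then $$\mathbb E\left[\|\hat T-T\|_{L^2(P_X)}^2\right]\lesssim\mathrm{PolyLog}(n,\epsilon)\times\max\left(\frac1n,\frac1{n^2\epsilon^2}\right).$$
   Context: **Central differential privacy.** A randomized mechanism $\mathcal M$ acting on datasets is $\epsilon$-central differentially private if $\mathbb P(\mathcal M(D)\in A)\le e^\epsilon\,\mathbb P(\mathcal M(D')\in A)$ for all neighboring datasets $D\sim D'$ and all measurable $A$. Here a dataset is a pair $D=((X_1,\dots,X_n),(Y_1,\dots,Y_n))$, and two datasets are neighboring if they differ by the replacement of exactly one coordinate, either in the $X$-sample or in the $Y$-sample but not both. **Conventions.** $\lesssim$ hides multiplicative constants not depending on $n$ or $\epsilon$; the statement is asymptotic in the regime $\min(n,n\epsilon)\to\infty$, with $\epsilon=\epsilon_n$ possibly depending on $n$; $\epsilon=\Omega(n^{-1+\gamma})$ means $\epsilon_n\ge c\,n^{-1+\gamma}$ for some constant $c>0$ and all large $n$ (here $\Omega(\cdot)$ is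 Landau notation, not the domain). $\mathrm{PolyLog}(n,\epsilon)$ denotes a factor bounded by a polynomial in $\log n$ and $|\log\epsilon|$. The optimal transport map is for the quadratic cost; in this one-dimensional setting $T=F_{f_Y}^{-1}\circ F_{f_X}$ with $F_{f_X}$ the cumulative distribution function of $f_X$ and $F_{f_Y}^{-1}$ the quantile function of $f_Y$. *)

(* Defs.v *)
From HB Require Import structures.
From mathcomp Require Import all_boot all_order all_algebra.
From mathcomp Require Import all_classical all_reals all_analysis.

Set Implicit Arguments.
Unset Strict Implicit.
Unset Printing Implicit Defensive.

Import Order.TTheory GRing.Theory Num.Theory.
Import numFieldNormedType.Exports.

Local Open Scope classical_set_scope.
Local Open Scope ring_scope.

Definition dataset (R : realType) (n : nat) : Type :=
  (n.-tuple R * n.-tuple R)%type.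

Definition in_unit (R : realType) (n : nat) (D : dataset R n) : Prop :=
  forall i : 'I_n, tnth D.1 i \in `[0, 1] /\ tnth D.2 i \in `[0, 1].

Definition differ_at_one (R : realType) (n : nat) (s t : n.-tuple R) : Prop :=
  exists i : 'I_n, tnth s i <> tnth t i /\
    forall j : 'I_n, j != i -> tnth s j = tnth t j.

Definition neighbors (R : realType) (n : nat) (D D' : dataset R n) : Prop :=
  (differ_at_one D.1 D'.1 /\ D.2 = D'.2) \/
  (D.1 = D'.1 /\ differ_at_one D.2 D'.2).

(* Only datasets with entries in [0, 1] are compared: the values of the kernel
   at other tuples of reals are irrelevant. *)
Definition central_dp (R : realType) (n : nat) (d : measure_display)
    (Z : measurableType d) (eps : R)
    (M : R.-pker (n.-tuple R * n.-tuple R)%type ~> Z) : Prop :=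
  forall D D' : dataset R n, in_unit D -> in_unit D' -> neighbors D D' ->
  forall A : set Z, measurable A ->
    (M D A <= (expR eps)%:E * M D' A)%E.

(* A randomized estimator of a map of the real line.  Given the dataset D, a
   random element z with law [mechanism D] is released, and the estimated map
   is [estimate z].  Since [estimate] is jointly measurable, privacy of
   [mechanism] on all measurable sets of [release] entails privacy of the law
   of the random map [estimate z]; it also makes the squared L^2 loss a
   measurable function of z. *)
Record estimator (R : realType) (n : nat) := Estimator {
  release_display : measure_display ;
  release : measurableType release_display ;
  mechanism : R.-pker (n.-tuple R * n.-tuple R)%type ~> release ;
  estimate : release -> R -> R ;
  measurable_estimate :
    measurable_fun [set: release * R] (fun zx => estimate zx.1 zx.2) }.

Definition private_estimator (R : realType) (n : nat) (eps : R)
    (E : estimator R n) : Prop := central_dp eps (mechanism E).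

Definition has_density01 (R : realType) (P : probability R R) (f : R -> R)
    : Prop :=
  measurable_fun (`[0, 1] : set R) f /\
  forall A : set R, measurable A ->
    P A = (\int[lebesgue_measure]_(x in A `&` `[0%R, 1%R]) (f x)%:E)%E.

Definition transports (R : realType) (P Q : probability R R) (S : R -> R)
    : Prop :=
  measurable_fun [set: R] S /\
  forall A : set R, measurable A -> pushforward P S A = Q A.

Definition quadratic_cost (R : realType) (P : probability R R) (S : R -> R)
    : \bar R :=
  (\int[P]_x ((x - S x) ^+ 2)%:E)%E.

Definition optimal_transport_map (R : realType) (P Q : probability R R)
    (T : R -> R) : Prop :=
  transports P Q T /\
  forall S : R -> R, transports P Q S ->
    (quadratic_cost P T <= quadratic_cost P S)%E.

(* Product rule for the whole family; the choice A i = setT yields it for all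
   subfamilies. *)
Definition mutually_independent (R : realType) (d : measure_display)
    (Omega : measurableType d) (Pr : probability Omega R) (I : finType)
    (Z : I -> {RV Pr >-> R}) : Prop :=
  forall A : I -> set R, (forall i, measurable (A i)) ->
    Pr (\bigcap_i (Z i @^-1` A i)) = (\prod_i Pr (Z i @^-1` A i))%E.

Definition iid_two_samples (R : realType) (n : nat) (d : measure_display)
    (Omega : measurableType d) (Pr : probability Omega R)
    (X Y : 'I_n -> {RV Pr >-> R}) (PX PY : probability R R) : Prop :=
  [/\ forall (i : 'I_n) (A : set R), measurable A ->
        distribution Pr (X i) A = PX A,
      forall (i : 'I_n) (A : set R), measurable A ->
        distribution Pr (Y i) A = PY A &
      mutually_independent
        (fun k : 'I_n + 'I_n => match k with inl i => X i | inr i => Y i end)].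

Definition sample_data (R : realType) (n : nat) (d : measure_display)
    (Omega : measurableType d) (Pr : probability Omega R)
    (X Y : 'I_n -> {RV Pr >-> R}) (w : Omega) : dataset R n :=
  ([tuple X i w | i < n], [tuple Y i w | i < n]).

(* The outer integral is over the samples, the inner one over the internal
   randomness of the mechanism given the samples. *)
Definition L2_risk (R : realType) (n : nat) (d : measure_display)
    (Omega : measurableType d) (Pr : probability Omega R)
    (X Y : 'I_n -> {RV Pr >-> R}) (E : estimator R n)
    (PX : probability R R) (T : R -> R) : \bar R :=
  (\int[Pr]_w \int[mechanism E (sample_data X Y w)]_z
     ('N[PX]_(2%:E)[EFin \o (estimate z \- T)%R]) ^+ 2)%E.

Definition polylog (R : realType) (L : nat -> R -> R) : Prop :=
  exists Q : {poly {poly R}}, forall (n : nat) (eps : R),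
    (0 < n)%N -> 0 < eps ->
    `|L n eps| <= (Q.[(ln n%:R)%:P]).[ `|ln eps| ].

Definition big_Omega_rate (R : realType) (gamma : R) (eps : nat -> R) : Prop :=
  exists2 c : R, 0 < c &
    \forall n \near \oo, c * n%:R `^ (gamma - 1) <= eps n.

(* Main.v *)
Require Import Defs.
From HB Require Import structures.
From mathcomp Require Import all_boot all_order all_algebra.
From mathcomp Require Import all_classical all_reals all_analysis.
From mathcomp Require Import measurable_realfun zify ring lra.

Set Implicit Arguments.
Unset Strict Implicit.
Unset Printing Implicit Defensive.

Import Order.TTheory GRing.Theory Num.Theory.
Import numFieldNormedType.Exports.

Local Open Scope classical_set_scope.
Local Open Scope ring_scope.

(** Each of the two samples is binned into 2^L >= n cells of [0, 1], and every
    count of points in a dyadic interval is released with truncated discrete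
    Laplace noise of rate eps / (4 L + 1).  A data point lies in one dyadic
    interval per scale, so replacing it moves the counts by at most 2 L in l^1
    norm; and a prefix [0, i / 2^L) is a disjoint union of at most L dyadic
    intervals, so both noisy distribution functions have, at each grid point, a
    mean squared error of order 1 / n + polylog / (n eps)^2.

    The map is estimated by
      That x = 2^-L #{j < 2^L : Fhat_Y (j / 2^L) < Fhat_X x}.
    As F_Y grows with slope at least a, an index j is misclassified only if the
    errors at x and at j / 2^L add up to at least a |j / 2^L - T x|.
    Cauchy-Schwarz with the weights 1 / (1 + |j - 2^L T x|), whose sum is
    O(L), bounds the mean of (That x - T x)^2 by O(L^2) times the pointwise mean
    squared error, so that no uniform control of the noise is needed.

    The identity F_Y (T x) = F_X x for the given optimal T comes from Kantorovich
    duality: with T0 the monotone map and phi a primitive of T0, the gap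
    phi x + phi^* y - x y in Young's inequality is nonnegative and vanishes only
    at y = T0 x, while its mean along a transport map S is, up to a constant,
    half of the cost of S. *)

(** * Dyadic decomposition of a prefix *)

(* The binary digits of i decompose [0, i) into dyadic intervals [j 2^h, (j + 1) 2^h),
   one for each h such that the digit of weight 2^h is 1. *)
Definition covers (i h j : nat) : bool :=
  odd (i %/ 2 ^ h) && (j == (i %/ 2 ^ h).-1)%N.

(** Induction on the number of digits: the term h = 0 accounts for t = i - 1 when i is odd, and the
    other terms form the same identity for i / 2 and t / 2. *)
Lemma dyadic_prefix (L i t : nat) : (i < 2 ^ L)%N ->
  ((t < i)%N : nat) = (\sum_(h < L) covers i h (t %/ 2 ^ h))%N.
Proof.
elim: L i t => [|L IH] i t.
  by rewrite expn0 ltnS leqn0 => /eqP ->; rewrite big_ord0.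
move=> hi; rewrite big_ord_recl /= /covers expn0 !divn1.
have hi2 : (i %/ 2 < 2 ^ L)%N by rewrite ltn_divLR // mulnC -expnS.
rewrite (_ : (\sum_(h < L) _)%N = (t %/ 2 < i %/ 2)%N); last first.
  rewrite (IH _ _ hi2); apply: eq_bigr => h _.
  by rewrite /covers /bump /= add1n expnS !divnMA.
have := divn_eq i 2; have := divn_eq t 2; rewrite !modn2.
case: (odd i) => /=; case: (ltnP t i); case: (ltnP (t %/ 2) (i %/ 2));
  case: (t =P i.-1); case: (odd t) => //=; lia.
Qed.

(** * Second moment of truncated two-sided geometric noise *)

Section GeometricNoise.
Variable R : realFieldType.

(** Two summations by parts, each costing a factor 1 / (1 - q), bring the weight k ^ 2 down to k and
    then to 1. *)
Lemma geometric_second_moment (q : R) (A : nat) : 0 <= q -> q < 1 ->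
  \sum_(k < A.+1) k%:R ^+ 2 * q ^+ k
  <= 2 / (1 - q) ^+ 2 * \sum_(k < A.+1) q ^+ k.
Proof.
move=> q0 q1; have q1' : 0 < 1 - q by rewrite subr_gt0.
(* The boundary term at [n] closes the induction; being nonnegative, it is dropped afterwards. *)
have s1 n : (1 - q) * (\sum_(k < n.+1) k%:R * q ^+ k) + n%:R * q ^+ n.+1
    <= \sum_(k < n.+1) q ^+ k.
  elim: n => [|n IH]; first by rewrite !big_ord_recr !big_ord0 /= !mul0r; lra.
  rewrite big_ord_recr [leRHS]big_ord_recr /=.
  rewrite -subr_ge0 (exprS q n.+1) -natr1; move: IH; rewrite -subr_ge0.
  set S := \sum_(k < _) _; set T := \sum_(k < _) _; set u := q ^+ n.+1; set x := n%:R.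
  move=> IH; rewrite (_ : _ - _ = S - ((1 - q) * T + x * u)) //; ring.
have s2 n : (1 - q) * (\sum_(k < n.+1) k%:R ^+ 2 * q ^+ k) + n%:R ^+ 2 * q ^+ n.+1
    <= 2 * \sum_(k < n.+1) k%:R * q ^+ k.
  elim: n => [|n IH]; first by rewrite !big_ord_recr !big_ord0 /= expr0n /= !mul0r; lra.
  rewrite big_ord_recr [in leRHS]big_ord_recr /=.
  rewrite -subr_ge0 (exprS q n.+1) -natr1; move: IH; rewrite -subr_ge0.
  have := exprn_ge0 n.+1 q0.
  set S := \sum_(k < _) _; set T := \sum_(k < _) _; set u := q ^+ n.+1; set x := n%:R => u0 IH.
  rewrite (_ : _ - _ = (2 * S - ((1 - q) * T + x ^+ 2 * u)) + u); first by rewrite addr_ge0.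
  by ring.
rewrite mulrAC ler_pdivlMr ?exprn_gt0 //.
have u1 := exprn_ge0 A.+1 q0; have nA : 0 <= (A%:R : R) by [].
have e1 := s1 A; have e2 := s2 A.
set S0 := \sum_(k < _) q ^+ k in e1 *.
set S1 := \sum_(k < _) k%:R * q ^+ k in e1 e2 *.
set S2 := \sum_(k < _) k%:R ^+ 2 * q ^+ k in e2 *.
have e1' : (1 - q) * S1 <= S0.
  by apply: le_trans e1; rewrite lerDl mulr_ge0.
have e2' : (1 - q) * S2 <= 2 * S1.
  by apply: le_trans e2; rewrite lerDl mulr_ge0 // exprn_ge0.
have : (1 - q) * ((1 - q) * S2) <= (1 - q) * (2 * S1) by rewrite ler_pM2l.
have -> : S2 * (1 - q) ^+ 2 = (1 - q) * ((1 - q) * S2) by ring.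
by move: e1' => e1' h; apply: le_trans h _; rewrite mulrCA ler_pM2l.
Qed.

(* The distance of two naturals: one of the two truncated differences is 0. *)
Definition ndist (c z : nat) : nat := ((c - z) + (z - c))%N.

(** The support splits into the distances 1, ..., c below c and 0, ..., n - c from c on;
    [geometric_second_moment] applies to each half. *)
Lemma truncated_noise_second_moment (q : R) (n c : nat) : 0 <= q -> q < 1 ->
  (c <= n)%N ->
  \sum_(z < n.+1) (z%:R - c%:R) ^+ 2 * q ^+ ndist c z
  <= 4 / (1 - q) ^+ 2 * \sum_(z < n.+1) q ^+ ndist c z.
Proof.
move=> q0 q1 cn.
have sq z : (z%:R - c%:R) ^+ 2 = (ndist c z)%:R ^+ 2 :> R.
  rewrite /ndist; case: (leqP c z) => h.
    by rewrite (eqP h) add0n natrB.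
  rewrite (_ : z - c = 0)%N ?addn0; last by lia.
  by rewrite natrB ?(ltnW h) // -[RHS]sqrrN opprB.
under eq_bigr do rewrite sq.
pose g (k : nat) := k%:R ^+ 2 * q ^+ k; pose g0 (k : nat) := q ^+ k.
have split_sum (f : nat -> R) : \sum_(z < n.+1) f (ndist c z) =
    \sum_(1 <= k < c.+1) f k + \sum_(k < (n - c).+1) f k.
  rewrite -(big_mkord xpredT (fun z => f (ndist c z))) (big_cat_nat (n := c)) //=; last by lia.
  congr (_ + _).
    rewrite big_nat_rev /= big_add1 /=; apply: eq_big_nat => k /andP[_ kc].
    by congr f; rewrite /ndist; lia.
  rewrite -{1}[c]add0n big_addn subSn // big_mkord.
  by apply: eq_bigr => k _; congr f; rewrite /ndist; lia.
rewrite (split_sum g) (split_sum g0).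
have C0 : 0 <= 2 / (1 - q) ^+ 2 by rewrite divr_ge0 // exprn_ge0 // subr_ge0 ltW.
have h1 : \sum_(1 <= k < c.+1) g k <= 2 / (1 - q) ^+ 2 * (1 + \sum_(1 <= k < c.+1) g0 k).
  have := geometric_second_moment c q0 q1.
  rewrite -(big_mkord xpredT g) -(big_mkord xpredT g0).
  rewrite (big_ltn (F := g)) // (big_ltn (F := g0)) //.
  by rewrite {1}/g {1}/g0 expr0n /= mul0r add0r expr0.
have h2 := geometric_second_moment (n - c) q0 q1.
(* The lower half has no term at distance 0. The 1 missing there is at most the upper half, which
   turns the constant 2 into 4. *)
have h3 : 1 <= \sum_(k < (n - c).+1) g0 k.
  rewrite big_ord_recl /g0 expr0 lerDl; apply: sumr_ge0 => k _; exact: exprn_ge0.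
rewrite (_ : 4 / (1 - q) ^+ 2 = 2 * (2 / (1 - q) ^+ 2)); last by rewrite mulrA -natrM.
move: h1 h2 h3 C0; rewrite -/g -/g0.
have : 0 <= \sum_(1 <= k < c.+1) g0 k by apply: sumr_ge0 => k _; exact: exprn_ge0.
rewrite /g -/(g0 _).
set x := 2 / _; set A := \sum_(1 <= k < _) _; set B := \sum_(1 <= k < _) _.
set D := \sum_(k < _) _; set E := \sum_(k < _) _. 
move=> B0 h1 h2 h3 x0.
have := ler_wpM2l x0 h3; have := mulr_ge0 x0 B0.
by move: h1; rewrite mulr1 mulrDr mulr1 -mulrA !mulrDr; lra.
Qed.

End GeometricNoise.

(** * The discrete Laplace mechanism *)

(** Cauchy-Schwarz by Lagrange's identity: twice the difference of the two sides is the double sum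
    of k i * k j * (x i - x j) ^ 2. *)
Lemma weighted_sum_sqr_le (R : realFieldType) (I : finType) (k x : I -> R) :
  (forall i, 0 <= k i) ->
  (\sum_i k i * x i) ^+ 2 <= (\sum_i k i) * \sum_i k i * x i ^+ 2.
Proof.
move=> k0; rewrite -subr_ge0.
have : 0 <= \sum_i \sum_j k i * k j * (x i - x j) ^+ 2.
  by apply: sumr_ge0 => i _; apply: sumr_ge0 => j _; rewrite mulr_ge0 ?sqr_ge0 // mulr_ge0 ?k0.
suff -> : \sum_i \sum_j k i * k j * (x i - x j) ^+ 2 =
    2 * ((\sum_i k i) * (\sum_i k i * x i ^+ 2) - (\sum_i k i * x i) ^+ 2).
  by rewrite pmulr_rge0.
have dist (f g : I -> R) : (\sum_i f i) * (\sum_j g j) = \sum_i \sum_j f i * g j.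
  by rewrite mulr_suml; apply: eq_bigr => i _; rewrite mulr_sumr.
rewrite mulrBr expr2 (_ : 2 * (_ * _) = (\sum_i k i) * (\sum_i k i * x i ^+ 2)
  + (\sum_i k i * x i ^+ 2) * (\sum_i k i)); last by ring.
rewrite !dist mulr_sumr -big_split -sumrB; apply: eq_bigr => i _ /=.
rewrite mulr_sumr -big_split -sumrB; apply: eq_bigr => j _ /=.
by ring.
Qed.

Section DiscreteLaplace.
Variables (R : realFieldType) (V : finType) (n : nat) (q : R).
Implicit Types (c : V -> nat) (z : {ffun V -> 'I_n.+1}).

Definition laplace_weight c z : R := \prod_v q ^+ ndist (c v) (z v).

(** The noisy counts are confined to 0, ..., n, which keeps the output space finite; the price is a
    normalising sum that depends on [c]. *)
Definition laplace_pmf c z : R :=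
  laplace_weight c z / \sum_(y : {ffun V -> 'I_n.+1}) laplace_weight c y.

Hypothesis q0 : 0 < q.

Lemma laplace_weight_gt0 c z : 0 < laplace_weight c z.
Proof. by apply: prodr_gt0 => v _; apply: exprn_gt0. Qed.

Lemma sum_laplace_weight_gt0 c :
  0 < \sum_(y : {ffun V -> 'I_n.+1}) laplace_weight c y.
Proof.
rewrite (bigD1 [ffun=> ord0]) //= ltr_pwDl ?laplace_weight_gt0 //.
by apply: sumr_ge0 => y _; apply/ltW/laplace_weight_gt0.
Qed.

Lemma laplace_pmf_ge0 c z : 0 <= laplace_pmf c z.
Proof.
by rewrite divr_ge0 // ltW ?laplace_weight_gt0 ?sum_laplace_weight_gt0.
Qed.

Lemma sum_laplace_pmf c : \sum_z laplace_pmf c z = 1.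
Proof. by rewrite -mulr_suml divff // gt_eqF // sum_laplace_weight_gt0. Qed.

Lemma laplace_weight_lipschitz c c' z D : q <= 1 ->
  (\sum_v ndist (c v) (c' v) <= D)%N ->
  q ^+ D * laplace_weight c z <= laplace_weight c' z.
Proof.
move=> q1 cD; rewrite /laplace_weight -!expr_sum -exprD.
apply: ler_wiXn2l => //; first exact: ltW.
apply: leq_trans (leq_add cD (leqnn _)); rewrite -big_split /=.
by apply: leq_sum => v _; rewrite /ndist; lia.
Qed.

(** The weight and the normalising sum each change by a factor of at most q ^ D in the unfavourable
    direction, hence the exponent 2 D. *)
Lemma laplace_pmf_private c c' z D : q <= 1 ->
  (\sum_v ndist (c v) (c' v) <= D)%N ->
  q ^+ (2 * D) * laplace_pmf c z <= laplace_pmf c' z.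
Proof.
move=> q1 cD; have c'D : (\sum_v ndist (c' v) (c v) <= D)%N.
  by apply: leq_trans cD; apply: leq_sum => v _; rewrite /ndist addnC.
rewrite /laplace_pmf ler_pdivlMr ?sum_laplace_weight_gt0 //.
rewrite mulrA mulrAC ler_pdivrMr ?sum_laplace_weight_gt0 //.
rewrite mul2n -addnn exprD.
rewrite (_ : _ * _ * _ * _ = (q ^+ D * laplace_weight c z) *
  (q ^+ D * \sum_(y : {ffun V -> 'I_n.+1}) laplace_weight c' y)); last by ring.
apply: ler_pM.
- by rewrite mulr_ge0 ?exprn_ge0 ?(ltW q0) ?(ltW (laplace_weight_gt0 _ _)).
- by rewrite mulr_ge0 ?exprn_ge0 ?(ltW q0) ?(ltW (sum_laplace_weight_gt0 _)).
- exact: laplace_weight_lipschitz.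
- by rewrite mulr_sumr; apply: ler_sum => y _; apply: laplace_weight_lipschitz.
Qed.

(** Weight and normalising sum are both products over the nodes, so every factor except the one at
    [v] cancels. *)
Lemma laplace_pmf_marginal c v (f : 'I_n.+1 -> R) :
  \sum_z laplace_pmf c z * f (z v) =
  (\sum_k f k * q ^+ ndist (c v) k) / \sum_(k < n.+1) q ^+ ndist (c v) k.
Proof.
pose w u (k : 'I_n.+1) := q ^+ ndist (c u) k.
have w0 u : 0 < \sum_k w u k.
  rewrite (bigD1 ord0) //= ltr_pwDl ?exprn_gt0 //.
  by apply: sumr_ge0 => y _; apply/ltW/exprn_gt0.
have wE : \sum_z laplace_weight c z = \prod_u \sum_k w u k.
  by rewrite bigA_distr_bigA.
rewrite /laplace_pmf wE; rewrite (eq_bigr (fun z => laplace_weight c z * f (z v) /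
  \prod_u \sum_k w u k)); last by move=> z _; rewrite mulrAC.
rewrite -mulr_suml.
have -> : \sum_z laplace_weight c z * f (z v) =
    \prod_u \sum_k w u k * (if u == v then f k else 1).
  rewrite bigA_distr_bigA; apply: eq_bigr => z _.
  rewrite big_split /=; congr (_ * _).
  by rewrite (bigD1 v) //= eqxx big1 ?mulr1 // => u /negPf ->.
rewrite (bigD1 v) //= eqxx [X in _ / X](bigD1 v) //=.
have -> : \prod_(u | u != v) \sum_k w u k * (if u == v then f k else 1) =
    \prod_(u | u != v) \sum_k w u k.
  apply: eq_bigr => u /negPf ->; apply: eq_bigr => k _; exact: mulr1.
set P := \prod_(u | _) _.
have P0 : P != 0 by rewrite gt_eqF //; apply: prodr_gt0 => u _.
rewrite -mulf_div divff // mulr1; congr (_ / _).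
by apply: eq_bigr => k _; rewrite mulrC.
Qed.

Lemma laplace_pmf_second_moment c v : q < 1 -> (c v <= n)%N ->
  \sum_z laplace_pmf c z * ((z v)%:R - (c v)%:R) ^+ 2 <= 4 / (1 - q) ^+ 2.
Proof.
move=> q1 cn.
rewrite (laplace_pmf_marginal c v (fun k => (k%:R - (c v)%:R) ^+ 2)).
rewrite ler_pdivrMr; first exact: truncated_noise_second_moment (ltW q0) q1 cn.
rewrite big_ord_recl ltr_pwDl ?exprn_gt0 //.
by apply: sumr_ge0 => y _; apply/ltW/exprn_gt0.
Qed.

(** Truncated noise need not be centred, so variances are not simply added. Cauchy-Schwarz with the
    weights [k] reduces the claim to one node at a time. *)
Lemma laplace_pmf_sum_second_moment c (k : V -> R) : q < 1 ->
  (forall v, c v <= n)%N -> (forall v, 0 <= k v) ->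
  \sum_z laplace_pmf c z * (\sum_v k v * ((z v)%:R - (c v)%:R)) ^+ 2
  <= (\sum_v k v) ^+ 2 * (4 / (1 - q) ^+ 2).
Proof.
move=> q1 cn k0.
have K0 : 0 <= \sum_v k v by apply: sumr_ge0.
apply: le_trans (_ : \sum_z laplace_pmf c z *
  ((\sum_v k v) * \sum_v k v * ((z v)%:R - (c v)%:R) ^+ 2) <= _).
  by apply: ler_sum => z _; rewrite ler_wpM2l ?laplace_pmf_ge0 ?weighted_sum_sqr_le.
under eq_bigr do rewrite mulrCA.
rewrite -mulr_sumr expr2 -mulrA ler_wpM2l //.
under eq_bigr do rewrite mulr_sumr.
rewrite exchange_big mulr_suml; apply: ler_sum => v _ /=.
under eq_bigr do rewrite mulrCA.
by rewrite -mulr_sumr ler_wpM2l // laplace_pmf_second_moment.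
Qed.

End DiscreteLaplace.

(** Functions of the binned data are shown to be measurable in this way: only the fibres of [f]
    matter, while [g] is arbitrary. *)
Lemma measurable_fun_countable d d' (T : measurableType d) (U : measurableType d')
    (C : countType) (f : T -> C) (g : C -> U) :
  (forall c, measurable (f @^-1` [set c])) -> measurable_fun setT (g \o f).
Proof.
move=> mf _ B _; rewrite setTI.
rewrite (_ : _ @^-1` B = \bigcup_(c in g @^-1` B) f @^-1` [set c]).
  rewrite bigcup_mkcond; apply: countable_bigcupT_measurable => // c.
  by case: ifP.
apply/seteqP; split => t /=; first by move=> gB; exists (f t).
by move=> [c gB /= ->].
Qed.

(** * Grid cells of the real line *)

Section Binning.
Variable R : realType.

(** Negative reals fall into cell 0, where truncation is 0, and x = 1 falls into cell m, just beyond
    the m cells of [0, 1). *)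
Definition bin (m : nat) (x : R) : nat := Num.truncn (m%:R * x).

Lemma bin_ltn (m i : nat) (x : R) :
  (bin m x < i)%N = (0 < i)%N && (m%:R * x < i%:R).
Proof. by case: i => [|i]; rewrite ?ltn0 // ltnS truncn_le_nat. Qed.

Lemma measurable_bin_lt (m i : nat) : measurable [set x : R | (bin m x < i)%N].
Proof.
case: i => [|i]; first by rewrite (_ : [set x | _] = set0) // -subset0.
rewrite (_ : [set x | _] = ( *%R (m%:R : R)) @^-1` `]-oo, i.+1%:R[%classic).
  rewrite -[X in measurable X]setTI; exact: mulrl_measurable.
by apply/seteqP; split => x /=; rewrite bin_ltn /= in_itv.
Qed.

Lemma measurable_bin_eq (m i : nat) : measurable (@bin m @^-1` [set i]).
Proof.
rewrite (_ : _ @^-1` _ =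
  [set x : R | (bin m x < i.+1)%N] `\` [set x : R | (bin m x < i)%N]).
  by apply: measurableD; apply: measurable_bin_lt.
by apply/seteqP; split => x /=; lia.
Qed.

End Binning.

(** * Private release of the dyadic counts *)

Section Mechanism.
Variables (R : realType) (n L : nat) (q : R).
Hypothesis q0 : 0 < q.

Definition binned (D : dataset R n) : {ffun bool * 'I_n -> nat} :=
  [ffun u => bin (2 ^ L) (tnth (if u.1 then D.1 else D.2) u.2)].

(* The node (s, h, j) stands for the dyadic interval
   [j 2^h / 2^L, (j + 1) 2^h / 2^L) in the X-sample (s = true) or in the
   Y-sample (s = false). *)
Definition cell_count (B : {ffun bool * 'I_n -> nat})
    (v : bool * 'I_L * 'I_(2 ^ L)) : nat :=
  \sum_(i < n) (B (v.1.1, i) %/ 2 ^ v.1.2 == v.2)%N.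

Lemma cell_count_le B v : (cell_count B v <= n)%N.
Proof.
apply: leq_trans (_ : \sum_(i < n) 1 <= n)%N; last by rewrite sum1_card card_ord.
by apply: leq_sum => i _; case: (_ == _).
Qed.

Lemma measurable_binned (B : {ffun bool * 'I_n -> nat}) :
  measurable (binned @^-1` [set B]).
Proof.
rewrite (_ : _ @^-1` _ = \bigcap_(u in [set: bool * 'I_n])
  (fun D : dataset R n => tnth (if u.1 then D.1 else D.2) u.2)
    @^-1` (bin (2 ^ L) @^-1` [set B u])).
  apply: fin_bigcap_measurable => // -[s i] _.
  have mf : measurable_fun setT
      (fun D : dataset R n => tnth (if s then D.1 else D.2) i).
    by case: s; apply: (measurableT_comp (measurable_tnth i)).
  by rewrite -[X in measurable X]setTI; apply: mf => //; exact: measurable_bin_eq.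
apply/seteqP; split => D /=.
  by move=> <- u _; rewrite /= ffunE.
by move=> H; apply/ffunP => u; rewrite ffunE; apply: H.
Qed.

Local Notation Z := {ffun bool * 'I_L * 'I_(2 ^ L) -> 'I_n.+1}.

(** What is released is the rank of a table of counts, so that the release space is [nat] with all
    subsets measurable. Ranks beyond the enumeration decode to the zero table. *)
Definition decode (k : nat) : Z := nth [ffun=> ord0] (enum {: Z}) k.

Lemma big_decode (S : Type) (idx : S) (op : Monoid.com_law idx) (F : Z -> S) :
  \big[op/idx]_(k < #|{: Z}|) F (decode k) = \big[op/idx]_z F z.
Proof.
rewrite -(big_mkord xpredT (F \o decode)) cardE -(big_nth _ xpredT).
by rewrite big_enum.
Qed.

Definition data_pmf (D : dataset R n) (z : Z) : R :=
  laplace_pmf q (cell_count (binned D)) z.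

Lemma data_pmf_ge0 D z : 0 <= data_pmf D z.
Proof. exact: laplace_pmf_ge0. Qed.

Definition laplace_mechanism (D : (n.-tuple R * n.-tuple R)%type) :
    {measure set nat -> \bar R} :=
  msum (fun k => mscale (NngNum (data_pmf_ge0 D (decode k))) \d_k) #|{: Z}|.

Lemma laplace_mechanismE D A : laplace_mechanism D A =
  (\sum_(k < #|{: Z}|) (data_pmf D (decode k))%:E * \d_(k : nat) A)%E.
Proof. by []. Qed.

Lemma integral_laplace_mechanism D (f : nat -> \bar R) : (forall k, 0 <= f k)%E ->
  (\int[laplace_mechanism D]_k f k =
   \sum_(k < #|{: Z}|) (data_pmf D (decode k))%:E * f k)%E.
Proof.
move=> f0; rewrite ge0_integral_measure_sum //; apply: eq_bigr => k _.
by rewrite ge0_integral_mscale //= integral_dirac // diracT mul1e.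
Qed.

Let measurable_laplace_mechanism U : measurable U ->
  measurable_fun setT (fun D => laplace_mechanism D U : \bar R).
Proof.
move=> _.
rewrite (_ : (fun D => _) = (fun B => \sum_(k < #|{: Z}|)
  (laplace_pmf q (cell_count B) (decode k))%:E * \d_(k : nat) U)%E \o binned) //.
by apply: measurable_fun_countable; apply: measurable_binned.
Qed.

HB.instance Definition _ := isKernel.Build _ _ _ _ _ laplace_mechanism
  measurable_laplace_mechanism.

Let laplace_mechanism_setT D : laplace_mechanism D setT = 1%E.
Proof.
rewrite laplace_mechanismE; under eq_bigr do rewrite diracT mule1.
by rewrite sumEFin big_decode sum_laplace_pmf.
Qed.

HB.instance Definition _ := Kernel_isProbability.Build _ _ _ _ _
  laplace_mechanism laplace_mechanism_setT.

Lemma sum_eq_indicator (m t : nat) : (\sum_(j < m) (t == j :> nat) <= 1)%N.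
Proof.
case: (ltnP t m) => tm; last first.
  rewrite big1 // => j _; case: eqP => // tj.
  by have := ltn_ord j; rewrite -tj ltnNge tm.
rewrite (bigD1 (Ordinal tm)) //= eqxx big1 // => j jt; case: eqP => // tj.
by case/eqP: jt; apply/val_inj.
Qed.

(** At each of the L scales only two counts can change, each by at most one: that of the cell which
    the replaced point leaves and that of the cell which it enters. *)
Lemma cell_count_sensitivity (D D' : dataset R n) : neighbors D D' ->
  (\sum_v ndist (cell_count (binned D) v) (cell_count (binned D') v) <= 2 * L)%N.
Proof.
move=> nDD'.
have [u0 Hu0] : exists u0, forall u, u != u0 -> binned D u = binned D' u.
  case: nDD' => [[[i [_ Hi]] D2]|[D1 [i [_ Hi]]]].
    exists (true, i) => -[s j]; rewrite !ffunE /= xpair_eqE; case: s => /=.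
      by move=> ji; rewrite Hi.
    by rewrite D2.
  exists (false, i) => -[s j]; rewrite !ffunE /= xpair_eqE; case: s => /=.
    by rewrite D1.
  by move=> ji; rewrite Hi.
pose t B (h : 'I_L) : nat := ((B : {ffun bool * 'I_n -> nat}) u0 %/ 2 ^ h)%N.
(* Entries other than [u0] contribute equally to both counts and cancel. *)
have bound (v : bool * 'I_L * 'I_(2 ^ L)) :
    (ndist (cell_count (binned D) v) (cell_count (binned D') v)
    <= (v.1.1 == u0.1) * ((t (binned D) v.1.2 == v.2) + (t (binned D') v.1.2 == v.2)))%N.
  case: v => -[s h] j /=; rewrite /cell_count /=.
  case: (eqVneq s u0.1) => [->|su]; last first.
    rewrite (eq_bigr (fun i => (binned D' (s, i) %/ 2 ^ h == j)%N : nat)).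
      by rewrite /ndist subnn.
    by move=> i _; rewrite Hu0 //; apply: contraNneq su => <-.
  rewrite (bigD1 u0.2) //= [X in ndist _ X](bigD1 u0.2) //=.
  rewrite (eq_bigr (fun i => (binned D' (u0.1, i) %/ 2 ^ h == j)%N : nat)); last first.
    by move=> i iu; rewrite Hu0 //; apply: contraNneq iu => <-.
  rewrite mul1n /t -!surjective_pairing /ndist !subnDr.
  by rewrite leq_add ?leq_subr.
apply: leq_trans (_ : \sum_v _ <= _)%N; first by apply: leq_sum => v _; exact: bound.
rewrite /=.
rewrite -(pair_bigA _ (fun (p : bool * 'I_L) (j : 'I_(2 ^ L)) => (p.1 == u0.1) *
  ((t (binned D) p.2 == j) + (t (binned D') p.2 == j)))%N) /=.
rewrite -(pair_bigA _ (fun (s : bool) (h : 'I_L) => \sum_(j < 2 ^ L) (s == u0.1) *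
  ((t (binned D) h == j) + (t (binned D') h == j)))%N) /=.
rewrite (bigD1 u0.1) //= [X in (_ + X)%N]big1 ?addn0; last first.
  by move=> s /negPf su; apply: big1 => h _; apply: big1 => j _; rewrite su.
rewrite mulnC -[X in (X * _)%N](card_ord L) -sum_nat_const.
apply: leq_sum => h _; rewrite eqxx.
under eq_bigr do rewrite mul1n.
by rewrite big_split /= (leq_add (sum_eq_indicator _ _) (sum_eq_indicator _ _)).
Qed.

(** The exponent is twice the sensitivity 2 L, because the normalising sum moves along with the
    weight. *)
Lemma laplace_mechanism_private (D D' : dataset R n) (A : set nat) : q <= 1 ->
  neighbors D D' ->
  ((q ^+ (4 * L))%:E * laplace_mechanism D A <= laplace_mechanism D' A)%E.
Proof.
move=> q1 nDD'; rewrite !laplace_mechanismE ge0_sume_distrr; last first.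
  by move=> k _; rewrite mule_ge0 // lee_fin data_pmf_ge0.
apply: lee_sum => k _; rewrite muleA; apply: lee_wpmul2r => //.
rewrite -EFinM lee_fin (_ : 4 * L = 2 * (2 * L))%N; last by rewrite mulnA.
by apply: laplace_pmf_private => //; exact: cell_count_sensitivity.
Qed.

End Mechanism.

(** * Inversion of the noisy distribution functions *)

Section PrefixEstimate.
Variable L : nat.
Local Notation node := (bool * 'I_L * 'I_(2 ^ L))%type.

Definition in_prefix (s : bool) (i : nat) (v : node) : bool :=
  (v.1.1 == s) && covers i v.1.2 v.2.

(** The table [u] is a parameter because the same sum is taken of the exact counts and of the noisy
    ones. *)
Definition prefix_est (u : node -> nat) (s : bool) (i : nat) : nat :=
  \sum_v in_prefix s i v * u v.

Lemma sum_node (f : node -> nat) (s : bool) :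
  (forall v, v.1.1 != s -> f v = 0)%N ->
  (\sum_v f v = \sum_(h < L) \sum_(j < 2 ^ L) f (s, h, j))%N.
Proof.
move=> f0; transitivity (\sum_s' \sum_(h < L) \sum_(j < 2 ^ L) f (s', h, j))%N.
  by rewrite 2!pair_bigA /=; apply: eq_bigr => -[[]].
rewrite (bigD1 s) //= [X in (_ + X)%N]big1 ?addn0 // => s' ss'.
by apply: big1 => h _; apply: big1 => j _; rewrite f0.
Qed.

Lemma sum_eq_mul (m t : nat) (f : nat -> nat) :
  (\sum_(j < m) f j * (t == j) = (t < m) * f t)%N.
Proof.
case: (ltnP t m) => tm; last first.
  rewrite big1 // => j _; case: eqP => [tj|_]; last by rewrite muln0.
  by have := ltn_ord j; rewrite -tj ltnNge tm.
rewrite (bigD1 (Ordinal tm)) //= eqxx big1 ?addn0 ?muln1 ?mul1n // => j jt.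
case: eqP => [tj|_]; last by rewrite muln0.
by case/eqP: jt; apply/val_inj.
Qed.

Lemma covers_lt (i h j : nat) : (i < 2 ^ L)%N -> covers i h j -> (j < 2 ^ L)%N.
Proof.
move=> iL /andP[_ /eqP ->]; apply: leq_ltn_trans (leq_pred _) _.
exact: leq_ltn_trans (leq_div _ _) iL.
Qed.

(** After exchanging the sums, [dyadic_prefix] applies to each data point. Without noise the
    estimate is thus n times the empirical distribution function. *)
Lemma prefix_est_cell_count n (B : {ffun bool * 'I_n -> nat}) s i :
  (i < 2 ^ L)%N ->
  prefix_est (cell_count B) s i = (\sum_(k < n) (B (s, k) < i))%N.
Proof.
move=> iL; rewrite /prefix_est (@sum_node _ s); last first.
  by move=> v /negPf vs; rewrite /in_prefix vs.
under eq_bigr do under eq_bigr do rewrite /cell_count big_distrr /=.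
under eq_bigr do rewrite exchange_big /=.
rewrite exchange_big; apply: eq_bigr => k _ /=.
rewrite (dyadic_prefix _ iL); apply: eq_bigr => h _.
rewrite /in_prefix /= eqxx /=.
rewrite (sum_eq_mul _ _ (fun j => covers i h j)).
case: ltnP => [|Lt]; first by rewrite mul1n.
by case: (boolP (covers _ _ _)) => // /(covers_lt iL); rewrite ltnNge Lt.
Qed.

(** Each scale contributes at most one node. *)
Lemma sum_in_prefix_le s i : (\sum_v in_prefix s i v <= L)%N.
Proof.
rewrite (@sum_node _ s); last by move=> v /negPf vs; rewrite /in_prefix vs.
rewrite -[X in (_ <= X)%N](card_ord L) -sum1_card; apply: leq_sum => h _.
apply: leq_trans (sum_eq_indicator (2 ^ L) (i %/ 2 ^ h).-1); apply: leq_sum => j _.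
by rewrite /in_prefix /covers eqxx /= eq_sym; case: odd => //=; case: eqP.
Qed.

Lemma prefix_estB (R : realFieldType) (u c : node -> nat) s i :
  (prefix_est u s i)%:R - (prefix_est c s i)%:R =
  \sum_v (in_prefix s i v)%:R * ((u v)%:R - (c v)%:R) :> R.
Proof.
rewrite /prefix_est !natr_sum -sumrB; apply: eq_bigr => v _.
by rewrite !natrM mulrBr.
Qed.

End PrefixEstimate.

Section DeterministicError.
Variable R : realFieldType.

(** As y is at most k, the sum counts all naturals below y and equals the ceiling of y. *)
Lemma sum_lt_approx (y : R) (k : nat) : 0 <= y -> y <= k%:R ->
  y <= \sum_(j < k) (j%:R < y)%R%:R <= y + 1.
Proof.
move=> y0.
have full l : l%:R <= y -> \sum_(j < l) (j%:R < y)%R%:R = l%:R :> R.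
  elim: l => [|l IH] ly; first by rewrite big_ord0.
  rewrite big_ord_recr /= IH; last by apply: le_trans ly; rewrite ler_nat.
  by rewrite (lt_le_trans _ ly) ?ltr_nat // -natr1.
elim: k => [|k IH] yk; first by rewrite big_ord0; lra.
rewrite big_ord_recr /=; case: (ltP k%:R y) => ky /=; last by rewrite addr0 IH.
by rewrite (full _ (ltW ky)) lerD2r (ltW ky) andbT natr1.
Qed.

(** Each block of indices from 2 ^ L to 2 ^ (L + 1) - 1 contributes at most 1, having 2 ^ L terms
    that are at most 2 ^ - L. *)
Lemma harmonic_pow2_le (L : nat) : \sum_(k < 2 ^ L) (k.+1%:R)^-1 <= L.+1%:R :> R.
Proof.
elim: L => [|L IH]; first by rewrite expn0 big_ord_recr big_ord0 /= add0r invr1.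
rewrite -(big_mkord xpredT (fun k => (k.+1%:R : R)^-1)) 
  (big_cat_nat (n := (2 ^ L)%N)) //=; last by rewrite leq_exp2l.
rewrite big_mkord -[L.+2%:R]natr1; apply: lerD => //.
apply: le_trans (_ : \sum_(2 ^ L <= k < 2 ^ L.+1) ((2 ^ L)%:R)^-1 <= _).
  rewrite big_nat_cond [leRHS]big_nat_cond; apply: ler_sum => k /andP[/andP[Lk _] _].
  by rewrite lef_pV2 ?posrE ?ltr0n ?expn_gt0 // ler_nat ltnW.
rewrite big_const_nat iter_addr addr0 expnS mul2n -addnn addnK.
by rewrite -(mulr_natr ((2 ^ L)%:R^-1)) mulVf // pnatr_eq0 expn_eq0.
Qed.

(** The indices on either side of [r] are dominated by one harmonic sum each. *)
Lemma sum_inv_ndist_le (L r : nat) : (r <= 2 ^ L)%N ->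
  \sum_(j < 2 ^ L) ((ndist j r).+1%:R)^-1 <= 2 * L.+1%:R :> R.
Proof.
move=> rL; have H := harmonic_pow2_le L.
pose f (k : nat) : R := (k.+1%:R)^-1.
have f0 k : 0 <= f k by rewrite invr_ge0.
rewrite -(big_mkord xpredT (fun j => f (ndist j r))) (big_cat_nat (n := r)) //=.
rewrite mulr_natl mulr2n; apply: lerD; apply: le_trans H.
  rewrite -(big_mkord xpredT f) (big_cat_nat (n := r) (p := (2 ^ L)%N)) //=.
  rewrite -[leLHS]addr0; apply: lerD; last by apply: sumr_ge0.
  rewrite big_nat_rev /= ; apply: ler_sum_nat => k /andP[_ kr].
  rewrite /f lef_pV2 ?posrE ?ltr0n // ler_nat ltnS /ndist; lia.
rewrite -{1}[r]add0n big_addn -(big_mkord xpredT f).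
rewrite [leRHS](big_cat_nat (n := (2 ^ L - r)%N)) //=; last exact: leq_subr.
rewrite -[leLHS]addr0; apply: lerD; last by apply: sumr_ge0.
apply: ler_sum_nat => k _.
rewrite /f lef_pV2 ?posrE ?ltr0n // ler_nat ltnS /ndist; lia.
Qed.

End DeterministicError.

Section Inversion.
Variable R : realType.

(** In the application [F] is the target distribution function, t = T x, [g] and [f] are noisy
    values, and [u] is the source distribution function at the grid point below x, hence the slack b
    / m. Counting the j with j < m t would give t up to 1 / m; the sum bounds the effect of the
    misclassified indices. *)
Lemma inversion_error (m : nat) (a b t f u : R) (F : R -> R) (g : nat -> R) :
  (0 < m)%N -> 0 < a -> 0 <= b -> 0 <= t <= 1 ->
  (forall y y' : R, 0 <= y -> y <= y' -> y' <= 1 -> a * (y' - y) <= F y' - F y) ->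
  u <= F t <= u + b / m%:R ->
  `|(\sum_(j < m) (g j < f)%R)%:R / m%:R - t| <= m%:R^-1 + a^-1 *
    \sum_(j < m) ((ndist j (bin m t)).+1%:R)^-1 *
      (`|g j - F (j%:R / m%:R)| + `|f - u| + (b + 2 * a) / m%:R).
Proof.
move=> m0 a0 b0 /andP[t0 t1] Fa /andP[uF Fu].
have mR : 0 < m%:R :> R by rewrite ltr0n.
have mt0 : 0 <= m%:R * t by rewrite mulr_ge0 // ltW.
have mt1 : m%:R * t <= m%:R by rewrite ler_piMr // ltW.
set r := bin m t.
have /andP[r1 r2] : r%:R <= m%:R * t < r.+1%:R by rewrite /r /bin truncn_itv.
pose E j := `|g j - F (j%:R / m%:R)| + `|f - u| + (b + 2 * a) / m%:R.
have E0 j : 0 <= E j.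
  by rewrite /E !addr_ge0 // divr_ge0 ?(ltW mR) // addr_ge0 // mulr_ge0 // ltW.
(* A misclassification is charged to the ratio of error to gap: if the two indicators differ, the
   errors are at least a |j / m - t|, so the right-hand side is at least 1. *)
have bad (j : 'I_m) : `|(g j < f)%R%:R - (j%:R < m%:R * t)%R%:R| <=
    m%:R / a * (((ndist j r).+1%:R)^-1 * E j).
  have rhs0 : 0 <= m%:R / a * (((ndist j r).+1%:R)^-1 * E j).
    by rewrite mulr_ge0 ?divr_ge0 ?mulr_ge0 ?invr_ge0 ?(ltW mR) ?(ltW a0).
  (* Rounding m t down to [r] and the summand 1 in the weight cost at most 2, which the term 2 a / m
     inside [E] pays for. *)
  have nd : (ndist j r).+1%:R <= `|j%:R - m%:R * t| + 2.
    rewrite -natr1 /ndist; case: (leqP j r) => jr.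
      rewrite (_ : (j - r = 0)%N); last exact/eqP.
      rewrite add0n natrB //.
      have : m%:R * t - j%:R <= `|j%:R - m%:R * t| by rewrite distrC ler_norm.
      lra.
    rewrite (_ : (r - j = 0)%N); last exact/eqP/ltnW.
    rewrite addn0 natrB; last exact: ltnW.
    have := ler_norm (j%:R - m%:R * t); rewrite -natr1 in r2.
    lra.
  have key : a * (`|j%:R - m%:R * t| / m%:R) <= E j - 2 * a / m%:R ->
      1 <= m%:R / a * (((ndist j r).+1%:R)^-1 * E j).
    move=> h; rewrite mulrCA mulrC ler_pdivlMr ?ltr0n // mul1r.
    apply: le_trans nd _; rewrite mulrAC ler_pdivlMr //.
    have -> : (`|j%:R - m%:R * t| + 2) * a =
      m%:R * (a * (`|j%:R - m%:R * t| / m%:R) + 2 * a / m%:R).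
      by field; rewrite gt_eqF.
    by rewrite ler_pM2l // -lerBrDr.
  have EE : E j - 2 * a / m%:R = `|g j - F (j%:R / m%:R)| + `|f - u| + b / m%:R.
    by rewrite /E; ring.
  have jm : 0 <= j%:R / m%:R :> R by rewrite divr_ge0 // ltW.
  have jm1 : j%:R / m%:R <= 1 :> R.
    by rewrite ler_pdivrMr // mul1r ler_nat ltnW.
  have n1 := ler_norm (g j - F (j%:R / m%:R)).
  have n2 := ler_norm (f - u).
  have n3 : - (g j - F (j%:R / m%:R)) <= `|g j - F (j%:R / m%:R)|.
    by rewrite -normrN ler_norm.
  have n4 : - (f - u) <= `|f - u| by rewrite -normrN ler_norm.
  have bm : 0 <= b / m%:R by rewrite divr_ge0 // ltW.
  (* In the two mismatched cases the slope bound for [F] between t and j / m supplies the gap. *)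
  case: (ltP (g j) f) => gf; case: (ltP j%:R (m%:R * t)) => jt.
  - by rewrite subrr normr0.
  - rewrite subr0 normr1; apply: key; rewrite EE ger0_norm ?subr_ge0 //.
    rewrite mulrBl [m%:R * t]mulrC mulfK ?gt_eqF //.
    have tj : t <= j%:R / m%:R by rewrite ler_pdivlMr // mulrC.
    have := Fa _ _ t0 tj jm1; lra.
  - rewrite sub0r normrN normr1; apply: key; rewrite EE ltr0_norm ?subr_lt0 //.
    rewrite opprB mulrBl [m%:R * t]mulrC mulfK ?gt_eqF //.
    have tj : j%:R / m%:R <= t by rewrite ler_pdivrMr // mulrC ltW.
    have := Fa _ _ jm tj t1; lra.
  - by rewrite subrr normr0.
have /andP[c1 c2] := sum_lt_approx mt0 mt1.
rewrite natr_sum.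
have -> : (\sum_(j < m) (g j < f)%R%:R) / m%:R - t =
  m%:R^-1 * ((\sum_(j < m) (j%:R < m%:R * t)%R%:R - m%:R * t) +
    \sum_(j < m) ((g j < f)%R%:R - (j%:R < m%:R * t)%R%:R)).
  by rewrite sumrB; field; rewrite gt_eqF.
rewrite normrM gtr0_norm ?invr_gt0 //.
rewrite -[X in _ <= X + _]mulr1 (_ : a^-1 * _ = m%:R^-1 *
  (\sum_(j < m) m%:R / a * (((ndist j r).+1%:R)^-1 * E j))); last first.
  rewrite -mulr_sumr mulrA; congr (_ * _); field.
  by rewrite !gt_eqF.
rewrite -mulrDr ler_pM2l ?invr_gt0 //.
apply: le_trans (ler_normD _ _) _; apply: lerD.
  by rewrite ger0_norm ?subr_ge0 // lerBlDl.
apply: le_trans (ler_norm_sum _ _ _) _; apply: ler_sum => j _; exact: bad.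
Qed.

(** Cauchy-Schwarz with the weights of [inversion_error], whose sum is at most 2 (L + 1). The
    factors 2 and 3 come from squaring sums of two and of three terms. *)
Lemma inversion_error_sqr (L : nat) (a b t f u : R) (F : R -> R) (g : nat -> R) :
  0 < a -> 0 <= b -> 0 <= t <= 1 ->
  (forall y y' : R, 0 <= y -> y <= y' -> y' <= 1 -> a * (y' - y) <= F y' - F y) ->
  u <= F t <= u + b / (2 ^ L)%:R ->
  ((\sum_(j < 2 ^ L) (g j < f)%R)%:R / (2 ^ L)%:R - t) ^+ 2
  <= 2 * (2 ^ L)%:R^-1 ^+ 2 + 4 * L.+1%:R / a ^+ 2 *
    \sum_(j < 2 ^ L) ((ndist j (bin (2 ^ L) t)).+1%:R)^-1 *
      (3 * ((g j - F (j%:R / (2 ^ L)%:R)) ^+ 2 + (f - u) ^+ 2 +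
        ((b + 2 * a) / (2 ^ L)%:R) ^+ 2)).
Proof.
move=> a0 b0 t01 Fa uF.
have m0 : (0 < 2 ^ L)%N by rewrite expn_gt0.
have := inversion_error f g m0 a0 b0 t01 Fa uF.
set X := _ / _ - t; set i1 := _^-1.
set S := \sum_(j < 2 ^ L) _ * (_ + _ + _) => hX.
have i10 : 0 <= i1 by rewrite invr_ge0.
have S0 : 0 <= S.
  apply: sumr_ge0 => j _; rewrite mulr_ge0 ?invr_ge0 // !addr_ge0 //.
  by rewrite divr_ge0 // addr_ge0 // mulr_ge0 // ltW.
have aS0 : 0 <= a^-1 * S by rewrite mulr_ge0 // invr_ge0 ltW.
have step1 : X ^+ 2 <= 2 * i1 ^+ 2 + 2 / a ^+ 2 * S ^+ 2.
  rewrite -real_normK ?num_real //.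
  apply: le_trans (_ : (i1 + a^-1 * S) ^+ 2 <= _).
    by rewrite ler_sqr ?nnegrE // addr_ge0.
  have -> : 2 / a ^+ 2 * S ^+ 2 = 2 * (a^-1 * S) ^+ 2 by field; rewrite gt_eqF.
  by have := sqr_ge0 (i1 - a^-1 * S); rewrite !expr2; lra.
apply: le_trans step1 _; rewrite lerD2l.
rewrite (_ : 4 * L.+1%:R / a ^+ 2 = 2 / a ^+ 2 * (2 * L.+1%:R)); last by ring.
rewrite -[leRHS]mulrA ler_wpM2l ?divr_ge0 ?sqr_ge0 //.
apply: le_trans (weighted_sum_sqr_le _ _) _; first by move=> j; rewrite invr_ge0.
apply: ler_pM.
- by apply: sumr_ge0 => j _; rewrite invr_ge0.
- by apply: sumr_ge0 => j _; rewrite mulr_ge0 ?invr_ge0 ?sqr_ge0.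
- apply: sum_inv_ndist_le; case/andP: t01 => t0 t1.
  rewrite /bin; rewrite truncn_le_nat (le_lt_trans (y := (2 ^ L)%:R)) //.
    by rewrite ler_piMr.
  by rewrite ltr_nat.
apply: ler_sum => j _; rewrite ler_wpM2l ?invr_ge0 //.
rewrite -(real_normK (num_real (g j - _))) -(real_normK (num_real (f - u))).
set x := `|_|; set y := `|_|; set z := _ / _.
have := sqr_ge0 (x - y); have := sqr_ge0 (x - z); have := sqr_ge0 (y - z).
by rewrite !expr2; lra.
Qed.

End Inversion.

(** * Risk for fixed data, averaged over the noise *)

Section ConditionalRisk.
Variables (R : realType) (n L : nat) (q : R).
Local Notation node := (bool * 'I_L * 'I_(2 ^ L))%type.
Local Notation Z := {ffun node -> 'I_n.+1}.

Definition noisy_count (z : Z) (v : node) : nat := z v.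

(** Raw counts are compared: both samples have size n, so dividing by n would not alter the
    inequality. *)
Definition transport_est (u : node -> nat) (x : R) : R :=
  (\sum_(j < 2 ^ L)
    (prefix_est u false j < prefix_est u true (bin (2 ^ L) x))%N)%:R / (2 ^ L)%:R.

Definition cdf_sqr_error (B : {ffun bool * 'I_n -> nat}) (s : bool) (i : nat)
  (p : R) : R := ((\sum_(k < n) (B (s, k) < i)%N)%:R / n%:R - p) ^+ 2.

(** Bound for the mean squared noise of a distribution function at a grid point: at most L nodes are
    added, each with second moment at most 4 / (1 - q) ^ 2. *)
Definition noise_level : R := L%:R ^+ 2 * (4 / (1 - q) ^+ 2) / n%:R ^+ 2.

(** The bound of [inversion_error_sqr] after averaging over the noise: each squared error becomes
    twice the noise level plus twice the squared sampling error. *)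
Definition risk_bound (a b : R) (B : {ffun bool * 'I_n -> nat}) (F G : R -> R)
    (i r : nat) : R :=
  2 * (2 ^ L)%:R^-1 ^+ 2 + 4 * L.+1%:R / a ^+ 2 *
    \sum_(j < 2 ^ L) ((ndist j r).+1%:R)^-1 *
      (3 * ((2 * noise_level + 2 * cdf_sqr_error B false j (G (j%:R / (2 ^ L)%:R))) +
            (2 * noise_level + 2 * cdf_sqr_error B true i (F (i%:R / (2 ^ L)%:R))) +
        ((b + 2 * a) / (2 ^ L)%:R) ^+ 2)).

Hypotheses (n0 : (0 < n)%N) (q0 : 0 < q) (q1 : q < 1).

Lemma noisy_prefix_sqr_error (B : {ffun bool * 'I_n -> nat}) s i p :
  (i < 2 ^ L)%N ->
  \sum_(z : Z) laplace_pmf q (cell_count B) z *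
    ((prefix_est (noisy_count z) s i)%:R / n%:R - p) ^+ 2
  <= 2 * noise_level + 2 * cdf_sqr_error B s i p.
Proof.
move=> iL; rewrite /cdf_sqr_error -(prefix_est_cell_count _ _ iL).
set c := cell_count B; set e := _ - p.
have nR : 0 < n%:R :> R by rewrite ltr0n.
pose k (v : node) : R := (in_prefix s i v)%:R.
apply: le_trans (_ : \sum_(z : Z) (2 / n%:R ^+ 2 * (laplace_pmf q c z *
    (\sum_v k v * ((z v)%:R - (c v)%:R)) ^+ 2) + laplace_pmf q c z * (2 * e ^+ 2)) <= _).
  apply: ler_sum => z _.
  rewrite [leRHS](_ : _ = laplace_pmf q c z * (2 / n%:R ^+ 2 *
    (\sum_v k v * ((z v)%:R - (c v)%:R)) ^+ 2 + 2 * e ^+ 2)); last by ring.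
  rewrite ler_wpM2l ?laplace_pmf_ge0 //.
  rewrite -(prefix_estB R (noisy_count z) c s i).
  set x := (prefix_est (noisy_count z) s i)%:R; set y := (prefix_est c s i)%:R in e *.
  have -> : x / n%:R - p = (x - y) / n%:R + e by rewrite /e; ring.
  have -> : 2 / n%:R ^+ 2 * (x - y) ^+ 2 = 2 * ((x - y) / n%:R) ^+ 2.
    by field; rewrite gt_eqF.
  by have := sqr_ge0 ((x - y) / n%:R - e); rewrite !expr2; lra.
rewrite big_split /= -mulr_sumr -mulr_suml sum_laplace_pmf // mul1r lerD2r.
rewrite /noise_level.
rewrite [leRHS](_ : _ = 2 / n%:R ^+ 2 * (L%:R ^+ 2 * (4 / (1 - q) ^+ 2))); last by ring.
rewrite ler_wpM2l ?divr_ge0 ?sqr_ge0 //.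
apply: le_trans (laplace_pmf_sum_second_moment q0 q1 _ _) _.
- by move=> v; apply: cell_count_le.
- by move=> v; apply: ler0n.
rewrite ler_wpM2r ?divr_ge0 ?sqr_ge0 // ler_sqr ?nnegrE ?ler0n //; last first.
  by apply: sumr_ge0 => v _; apply: ler0n.
by rewrite -natr_sum ler_nat sum_in_prefix_le.
Qed.

Lemma conditional_risk (a b t x : R) (B : {ffun bool * 'I_n -> nat})
    (F G : R -> R) :
  0 < a -> 0 <= b -> 0 <= t <= 1 ->
  (forall y y' : R, 0 <= y -> y <= y' -> y' <= 1 -> a * (y' - y) <= G y' - G y) ->
  let i := bin (2 ^ L) x in (i < 2 ^ L)%N ->
  F (i%:R / (2 ^ L)%:R) <= G t <= F (i%:R / (2 ^ L)%:R) + b / (2 ^ L)%:R ->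
  \sum_(z : Z) laplace_pmf q (cell_count B) z * (transport_est (noisy_count z) x - t) ^+ 2
  <= risk_bound a b B F G i (bin (2 ^ L) t).
Proof.
move=> a0 b0 t01 Ga i iL FG.
have nR : 0 < n%:R :> R by rewrite ltr0n.
pose p (z : Z) := laplace_pmf q (cell_count B) z.
have p0 z : 0 <= p z by apply: laplace_pmf_ge0.
have p1 : \sum_z p z = 1 by apply: sum_laplace_pmf.
pose kr (j : 'I_(2 ^ L)) : R := ((ndist j (bin (2 ^ L) t)).+1%:R)^-1.
have kr0 j : 0 <= kr j by rewrite invr_ge0.
pose Y (z : Z) (j : nat) :=
  ((prefix_est (noisy_count z) false j)%:R / n%:R - G (j%:R / (2 ^ L)%:R)) ^+ 2.
pose X (z : Z) := ((prefix_est (noisy_count z) true i)%:R / n%:R - F (i%:R / (2 ^ L)%:R)) ^+ 2.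
pose be : R := ((b + 2 * a) / (2 ^ L)%:R) ^+ 2.
pose A := 4 * L.+1%:R / a ^+ 2.
have A0 : 0 <= A by rewrite divr_ge0 ?sqr_ge0.
apply: le_trans (_ : \sum_z p z * (2 * (2 ^ L)%:R^-1 ^+ 2 +
    A * \sum_j kr j * (3 * (Y z j + X z + be))) <= _).
  apply: ler_sum => z _; rewrite ler_wpM2l //.
  rewrite /transport_est -/i.
  have -> : (\sum_(j < 2 ^ L)
      (prefix_est (noisy_count z) false j < prefix_est (noisy_count z) true i)%N)%N =
      (\sum_(j < 2 ^ L) ((prefix_est (noisy_count z) false j)%:R / n%:R <
        (prefix_est (noisy_count z) true i)%:R / n%:R :> R)%R)%N.
    by apply: eq_bigr => j _; rewrite ltr_pM2r ?invr_gt0 // ltr_nat.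
  exact: (inversion_error_sqr _
    (fun j => (prefix_est (noisy_count z) false j)%:R / n%:R) a0 b0 t01 Ga FG).
under eq_bigr do rewrite mulrDr.
rewrite big_split /= -mulr_suml p1 mul1r /risk_bound lerD2l -/A.
rewrite (eq_bigr (fun z =>
  A * \sum_j kr j * (3 * (p z * Y z j + p z * X z + p z * be)))); last first.
  move=> z _; rewrite mulrCA; congr (_ * _); rewrite mulr_sumr; apply: eq_bigr => j _.
  by ring.
rewrite -mulr_sumr ler_wpM2l // exchange_big /=; apply: ler_sum => j _.
rewrite -mulr_sumr ler_wpM2l // -mulr_sumr ler_wpM2l // !big_split /=.
rewrite -[X in _ + X <= _]mulr_suml p1 mul1r lerD2r; apply: lerD.
  by apply: noisy_prefix_sqr_error.
exact: noisy_prefix_sqr_error.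
Qed.

End ConditionalRisk.

(** * Sampling error *)

Section EmpiricalVariance.
Context d (Omega : measurableType d) (R : realType) (Pr : probability Omega R).

Lemma integral_sum_indic (I : finType) (c : I -> R) (E : I -> set Omega) :
  (forall i, 0 <= c i) -> (forall i, measurable (E i)) ->
  (\int[Pr]_w (\sum_i c i * \1_(E i) w)%:E = (\sum_i c i * fine (Pr (E i)))%:E)%E.
Proof.
move=> c0 mE.
have mi i : measurable_fun setT (fun w => (\1_(E i) w : R)%:E).
  by apply/measurable_EFinP; exact: measurable_indic.
under eq_integral do rewrite -sumEFin.
rewrite ge0_integral_sum //; last 2 first.
- move=> i; under eq_fun do rewrite EFinM.
  by apply: measurable_funeM; exact: mi.
- by move=> i w _; rewrite lee_fin mulr_ge0.
rewrite -sumEFin; apply: eq_bigr => i _.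
under eq_integral do rewrite EFinM.
rewrite ge0_integralZl_EFin //.
by rewrite integral_indic // setIT EFinM fineK // fin_num_measure.
Qed.

(** Expanding the square into indicators of pairs gives p / n on the diagonal and (1 - 1 / n) p ^ 2
    off it; the result p (1 - p) / n is at most 1 / n. *)
Lemma empirical_variance (n : nat) (E : 'I_n -> set Omega) (p : R) :
  (0 < n)%N -> (forall k, measurable (E k)) -> (forall k, Pr (E k) = p%:E) ->
  (forall k l, k != l -> Pr (E k `&` E l) = (p * p)%:E) ->
  (\int[Pr]_w (((\sum_k \1_(E k) w) / n%:R - p) ^+ 2)%:E <= (n%:R^-1)%:E)%E.
Proof.
move=> n0 mE Ep Epp; have nR : 0 < n%:R :> R by rewrite ltr0n.
have p0 : 0 <= p by rewrite -lee_fin -(Ep (Ordinal n0)).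
have p1 : p <= 1 by rewrite -lee_fin -(Ep (Ordinal n0)) probability_le1.
pose S w : R := \sum_k \1_(E k) w.
pose f w : R := (S w / n%:R - p) ^+ 2.
have mS : measurable_fun setT S.
  by apply: measurable_sum => k; exact: measurable_indic.
have mf : measurable_fun setT f.
  apply: measurable_funX; apply: measurable_funB => //.
  exact: measurable_funM.
have S1 : (\int[Pr]_w (\sum_k (2 * p / n%:R) * \1_(E k) w)%:E)%E = (2 * p ^+ 2)%:E.
  rewrite integral_sum_indic //; last by move=> k; rewrite divr_ge0 ?mulr_ge0.
  congr (_ %:E); under eq_bigr do rewrite Ep /=.
  by rewrite sumr_const card_ord -mulr_natr; field; rewrite gt_eqF.
have S2 : (\int[Pr]_w (\sum_(u : 'I_n * 'I_n) ((n%:R : R)^-1 ^+ 2) * \1_(E u.1 `&` E u.2) w)%:E)%E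
    = (n%:R^-1 * p + (1 - n%:R^-1) * p ^+ 2)%:E.
  rewrite integral_sum_indic //; last by move=> u; exact: measurableI.
  congr (_ %:E); rewrite -mulr_sumr.
  rewrite -(pair_bigA _ (fun k l => fine (Pr (E k `&` E l)))) /=.
  rewrite (eq_bigr (fun=> p + (n%:R - 1) * p ^+ 2)); last first.
    move=> k _; rewrite (bigD1 k) //= setIid Ep /=; congr (_ + _).
    rewrite (eq_bigr (fun=> p ^+ 2)); last by move=> l lk; rewrite Epp // eq_sym.
    rewrite sumr_const cardC1 card_ord -(mulr_natl (p ^+ 2)); congr (_ * _).
    by rewrite -subn1 natrB.
  by rewrite sumr_const card_ord -mulr_natr; field; rewrite gt_eqF.
(* The square is moved to a side on which all terms are nonnegative, so that the
   integral is additive without integrability conditions. *)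
have eqf w : (f w)%:E + (\sum_k (2 * p / n%:R) * \1_(E k) w)%:E =
    ((\sum_(u : 'I_n * 'I_n) ((n%:R : R)^-1 ^+ 2) * \1_(E u.1 `&` E u.2) w)%:E + (p ^+ 2)%:E)%E.
  rewrite -!EFinD; congr (_ %:E).
  rewrite -!mulr_sumr -/(S w).
  rewrite -(pair_bigA _ (fun k l => \1_(E k `&` E l) w)) /=.
  have -> : \sum_k \sum_l \1_(E k `&` E l) w = S w ^+ 2.
    rewrite expr2 mulr_suml; apply: eq_bigr => k _.
    by rewrite mulr_sumr; apply: eq_bigr => l _; rewrite indicI.
  by rewrite /f; field; rewrite gt_eqF.
have : (\int[Pr]_w (f w)%:E + (2 * p ^+ 2)%:E =
    (n%:R^-1 * p + (1 - n%:R^-1) * p ^+ 2)%:E + (p ^+ 2)%:E)%E.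
  rewrite -S1 -S2.
  have mI1 : measurable_fun setT (fun w => (\sum_k (2 * p / n%:R) * \1_(E k) w)%:E).
    apply/measurable_EFinP; apply: measurable_sum => k.
    by apply: measurable_funM => //; exact: measurable_indic.
  have mI2 : measurable_fun setT (fun w =>
      (\sum_(u : 'I_n * 'I_n) ((n%:R : R)^-1 ^+ 2) * \1_(E u.1 `&` E u.2) w)%:E).
    apply/measurable_EFinP; apply: measurable_sum => u.
    by apply: measurable_funM => //; apply: measurable_indic; apply: measurableI.
  have mf' : measurable_fun setT (fun w => (f w)%:E) by apply/measurable_EFinP.
  have f0 w : setT w -> (0 <= (f w)%:E)%E by rewrite lee_fin sqr_ge0.
  have I10 w : setT w -> (0 <= (\sum_k (2 * p / n%:R) * \1_(E k) w)%:E)%E.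
    by rewrite lee_fin sumr_ge0 // => k _; rewrite mulr_ge0 // divr_ge0 ?mulr_ge0.
  have I20 w : setT w ->
      (0 <= (\sum_(u : 'I_n * 'I_n) ((n%:R : R)^-1 ^+ 2) * \1_(E u.1 `&` E u.2) w)%:E)%E.
    by rewrite lee_fin sumr_ge0 // => u _; rewrite mulr_ge0 // sqr_ge0.
  rewrite -ge0_integralD //.
  under eq_integral do rewrite eqf.
  rewrite ge0_integralD //; last by move=> w _; rewrite lee_fin sqr_ge0.
  by congr (_ + _)%E; rewrite integral_cst //= probability_setT mule1.
rewrite -/(f _); case: (\int[Pr]_w _)%E => [r| |] //=.
rewrite -!EFinD => -[e]; rewrite lee_fin.
have ni : 0 < n%:R^-1 :> R by rewrite invr_gt0.
by nra.
Qed.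

End EmpiricalVariance.

Section SampleError.
Variables (R : realType) (n L : nat).
Context d (Omega : measurableType d) (Pr : probability Omega R).
Variables (X Y : 'I_n -> {RV Pr >-> R}) (PX PY : probability R R).
Hypotheses (n0 : (0 < n)%N) (XY : iid_two_samples X Y PX PY).

(** The product rule with the whole line at all indices other than [k] and [l]. *)
Lemma iid_pair_measure (k l : 'I_n + 'I_n) (A : set R) : measurable A -> k != l ->
  let V u := match u with inl i => X i | inr i => Y i end in
  Pr ((V k @^-1` A) `&` (V l @^-1` A)) = (Pr (V k @^-1` A) * Pr (V l @^-1` A))%E.
Proof.
move=> mA kl V; have [_ _ ind] := XY.
have := ind (fun u => if (u == k) || (u == l) then A else setT).
rewrite (bigD1 k) //= (bigD1 l) //=; last by rewrite eq_sym.
rewrite !eqxx orbT /= big1 ?mule1; last first.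
  move=> u /andP[/negPf -> /negPf ->] /=.
  by rewrite preimage_setT probability_setT.
move=> <-; last by move=> u; case: ifP.
congr (Pr _); apply/seteqP; split => w /=.
  by move=> [Ak Al] u _; case: ifP => // /orP[] /eqP ->.
by move=> H; split; [have := H k I | have := H l I]; rewrite eqxx ?orbT.
Qed.

Lemma expected_cdf_sqr_error (s : bool) (i : nat) :
  (\int[Pr]_w (cdf_sqr_error (binned L (sample_data X Y w)) s i
     (fine ((if s then PX else PY) [set x | (bin (2 ^ L) x < i)%N])))%:E
   <= (n%:R^-1)%:E)%E.
Proof.
set A := [set x | _].
have mA : measurable A by exact: measurable_bin_lt.
pose V (u : 'I_n + 'I_n) := match u with inl i => X i | inr i => Y i end.
pose u (k : 'I_n) : 'I_n + 'I_n := if s then inl k else inr k.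
pose E (k : 'I_n) := V (u k) @^-1` A.
have mE k : measurable (E k) by rewrite /E -[X in measurable X]setTI; exact: measurable_funP.
have Ep k : Pr (E k) = (fine ((if s then PX else PY) A))%:E.
  have [HX HY _] := XY; rewrite /E /V /u.
  by case: (s); rewrite fineK ?fin_num_measure //; [rewrite -(HX k A mA) | rewrite -(HY k A mA)].
have uinj k l : k != l -> u k != u l.
  by apply: contraNneq; rewrite /u; case: (s) => -[->].
rewrite [leLHS](_ : _ = (\int[Pr]_w (((\sum_k \1_(E k) w) / n%:R
    - fine ((if s then PX else PY) A)) ^+ 2)%:E)%E).
  apply: empirical_variance => // k l kl; rewrite EFinM.
  by rewrite iid_pair_measure ?uinj // -!/(E _) !Ep.
apply: eq_integral => w _; rewrite /cdf_sqr_error natr_sum.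
congr ((_ / _ - _) ^+ 2)%:E; apply: eq_bigr => k _.
rewrite ffunE /= indicE /E /V /u; congr (_%:R).
case: (s) => /=; rewrite tnth_mktuple.
  by congr nat_of_bool; apply/idP/idP; [move=> h; rewrite inE | rewrite inE].
by congr nat_of_bool; apply/idP/idP; [move=> h; rewrite inE | rewrite inE].
Qed.

End SampleError.

(** * Distribution functions and the one-dimensional transport map *)

(** The half-line is open to match the prefixes [0, i / 2 ^ L); for a law with a density this is the
    usual distribution function. *)
Definition lcdf (R : realType) (P : probability R R) (x : R) : R :=
  fine (P `]-oo, x[%classic).

(** Open half-lines are stable under intersection and generate the Borel sets. *)
Lemma probability_eq_lcdf (R : realType) (P Q : probability R R) :
  (forall x, P `]-oo, x[%classic = Q `]-oo, x[%classic) ->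
  forall A, measurable A -> P A = Q A.
Proof.
move=> PQ A mA.
refine (@g_sigma_algebra_measure_unique _ _ _ (@RGenInftyO.G R) _
  (fun n : nat => `]-oo, n%:R[%classic) _ _ P Q _ _ _ A _).
- by move=> _ [x ->]; exact: measurable_itv.
- by move=> n; exists n%:R.
- apply/seteqP; split => // x _.
  by exists (Num.truncn x).+1 => //=; rewrite in_itv /= truncnS_gt.
- move=> _ _ [x ->] [y ->]; exists (Num.min x y).
  by apply/seteqP; split => z /=; rewrite !in_itv /= lt_min => /andP.
- by move=> _ [x ->]; exact: PQ.
- by move=> n; rewrite (le_lt_trans (probability_le1 _ _)) ?ltry.
- exact: (eq_ind _ id mA _
    (congr1 (fun S : set (set R) => S A) (RGenInftyO.measurableE R))).
Qed.

Definition bounded_density (R : realType) (a b : R) (P : probability R R) : Prop :=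
  [/\ 0 < a, a < b & exists2 f, has_density01 P f &
     forall x : R, x \in `[0, 1] -> a <= f x <= b].

Section BoundedDensity.
Variables (R : realType) (P : probability R R) (a b : R).
Hypothesis hP : bounded_density a b P.
Local Notation mu := (@lebesgue_measure R).

Let a0 : 0 < a. Proof. by case: hP. Qed.

Let b0 : 0 < b. Proof. by case: hP => _ ab _; exact: lt_trans ab. Qed.

Lemma density_bounds (A : set R) : measurable A ->
  (a%:E * mu (A `&` `[0%R, 1%R]) <= P A <= b%:E * mu (A `&` `[0%R, 1%R]))%E.
Proof.
move=> mA; have [_ _ [f [mf Pf] fab]] := hP; rewrite Pf //.
have mA' : measurable (A `&` `[0, 1]) by apply: measurableI.
have mfA : measurable_fun (A `&` `[0, 1]) (fun x => (f x)%:E).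
  by apply/measurable_EFinP; apply: measurable_funS mf => // x [].
have fx x : (A `&` `[0, 1]) x -> a <= f x <= b by move=> [_ /= x01]; apply: fab.
rewrite -!integral_cst //; apply/andP; split; apply: ge0_le_integral => //.
- by move=> x _; rewrite lee_fin ltW.
- by move=> x /fx /andP[? _]; rewrite lee_fin.
- by move=> x /fx /andP[? _]; rewrite lee_fin (le_trans (ltW a0)).
- by move=> x /fx /andP[_ ?]; rewrite lee_fin.
Qed.

(** The lower slope makes inversion stable; the upper slope controls the rounding of x to the
    grid. *)
Lemma lcdf_increment (x y : R) : 0 <= x -> x <= y -> y <= 1 ->
  a * (y - x) <= lcdf P y - lcdf P x <= b * (y - x).
Proof.
move=> x0 xy y1.
have eqU : `]-oo, y[%classic = `]-oo, x[%classic `|` `[x, y[%classic :> set R.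
  by rewrite -itv_bndbnd_setU // bnd_simp.
have -> : lcdf P y - lcdf P x = fine (P `[x, y[%classic).
  rewrite /lcdf eqU measureU //=; last first.
    apply/seteqP; split => // z [] /=; rewrite !in_itv /= => zx /andP[xz _].
    by move: zx; rewrite ltNge xz.
  by rewrite fineD ?fin_num_measure // addrC addKr.
have /andP := density_bounds (measurable_itv `[x, y[).
have -> : `[x, y[ `&` `[0, 1] = `[x, y[%classic :> set R.
  apply/seteqP; split => z /=; rewrite !in_itv /=; first by case.
  by move=> /andP[xz zy]; rewrite xz zy (le_trans x0 xz) (ltW (lt_le_trans zy y1)).
rewrite lebesgue_measure_itv /= lte_fin.
rewrite -[P _]fineK ?fin_num_measure //.
case: ltP => xy'; first by rewrite -EFinB -!EFinM !lee_fin => -[-> ->].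
rewrite (_ : y = x); last by apply/eqP; rewrite eq_le xy xy'.
by rewrite subrr !mulr0 !mule0 !lee_fin => -[-> ->].
Qed.

(** The point 1 is discarded too, so that almost every x has a cell index below 2 ^ L. *)
Lemma probability_compl01 : P (~` `[0, 1[%classic) = 0%E.
Proof.
have mC : measurable (~` (`[0, 1[%classic : set R)) by apply: measurableC.
have /andP[_] := density_bounds mC.
have -> : ~` `[0, 1[ `&` `[0, 1] = [set 1] :> set R.
  apply/seteqP; split => z /=; rewrite !in_itv /=.
    move=> [/negP]; rewrite negb_and -!ltNge => /orP[z0|z1] /andP[z0' z1'].
      by move: z0; rewrite ltNge z0'.
    by apply/eqP; rewrite eq_le z1' leNgt; move: z1; rewrite -leNgt => ->.
  by move=> ->; rewrite ltxx andbF ler01 lexx.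
rewrite lebesgue_measure_set1 mule0 => h.
by apply/eqP; rewrite eq_le h measure_ge0.
Qed.

Lemma ae_in01 : {ae P, forall x, 0 <= x < 1}.
Proof.
exists (~` `[0, 1[%classic); split; first exact: measurableC.
  exact: probability_compl01.
by move=> x /=; rewrite in_itv.
Qed.

Lemma lcdf_le0 (x : R) : x <= 0 -> lcdf P x = 0.
Proof.
move=> x0; rewrite /lcdf (_ : P _ = 0%E) //.
apply: subset_measure0 probability_compl01 => //.
  exact: measurableC.
by move=> z /=; rewrite !in_itv /= => zx /andP[z0 _]; lra.
Qed.

Lemma lcdf01 (x : R) : 0 <= lcdf P x <= 1.
Proof.
rewrite /lcdf fine_ge0 //= -[1]/(fine 1%E) fine_le ?fin_num_measure //.
exact: probability_le1.
Qed.

Lemma lcdf_homo (x y : R) : x <= y -> lcdf P x <= lcdf P y.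
Proof.
move=> xy; rewrite /lcdf fine_le ?fin_num_measure // le_measure ?inE //.
by apply: subset_itvl; rewrite bnd_simp.
Qed.

Lemma lcdf1 : lcdf P 1 = 1.
Proof.
apply/eqP; rewrite eq_le; have /andP[_ ->] := lcdf01 1 => /=.
rewrite -lee_fin /lcdf fineK ?fin_num_measure //.
rewrite -(probability_setT P) -(setUv `[0, 1[%classic).
apply: le_trans (measureU2 _ _ _) _ => //; first exact: measurableC.
rewrite [X in (_ + X)%E](_ : _ = 0%E) ?adde0; last exact: probability_compl01.
rewrite le_measure ?inE //; apply: subset_itv => //.
Qed.

Lemma lcdf_ge1 (x : R) : 1 <= x -> lcdf P x = 1.
Proof.
move=> /lcdf_homo; rewrite lcdf1 => h; apply/eqP; rewrite eq_le h andbT.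
by case/andP: (lcdf01 x).
Qed.

Lemma lcdf_lt (x y : R) : 0 <= x -> x < y -> y <= 1 -> lcdf P x < lcdf P y.
Proof.
move=> x0 xy y1; have /andP[h _] := lcdf_increment x0 (ltW xy) y1.
have : 0 < a * (y - x) by rewrite mulr_gt0 ?subr_gt0.
lra.
Qed.

Lemma lcdf_inj (x y : R) : 0 <= x <= 1 -> 0 <= y <= 1 -> lcdf P x = lcdf P y -> x = y.
Proof.
move=> /andP[x0 x1] /andP[y0 y1] e; case: (ltgtP x y) => // [/(lcdf_lt x0)|/(lcdf_lt y0)].
  by move=> /(_ y1); rewrite e ltxx.
by move=> /(_ x1); rewrite e ltxx.
Qed.

Lemma lcdf_lipschitz (x y : R) : `|lcdf P x - lcdf P y| <= b * `|x - y|.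
Proof.
wlog xy : x y / x <= y => [hw|].
  by have [/hw//|/ltW /hw] := leP x y; rewrite distrC [`|y - x|]distrC.
(* Projecting onto [0, 1] preserves the value of [lcdf] and does not increase distances. *)
have cl (z : R) : exists z', [/\ 0 <= z' <= 1, lcdf P z' = lcdf P z &
    [\/ z <= 0 /\ z' = 0, 0 <= z <= 1 /\ z' = z | 1 <= z /\ z' = 1]].
  have [z0|z0] := leP z 0.
    by exists 0; split; rewrite ?lexx ?ler01 ?lcdf_le0 //; apply: Or31.
  have [z1|z1] := leP z 1.
    have z01 : 0 <= z <= 1 by rewrite (ltW z0) z1.
    by exists z; split => //; apply: Or32; rewrite (ltW z0).
  exists 1; split; [by rewrite ler01 lexx | | by apply: Or33; rewrite ltW].
  by rewrite !lcdf_ge1 ?lexx // ltW.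
have [x' [/andP[x0 x1] <- xE]] := cl x; have [y' [/andP[y0 y1] <- yE]] := cl y.
have [xy' xyb] : x' <= y' /\ y' - x' <= y - x.
  case: xE => [[? ->]|[/andP[? ?] ->]|[? ->]];
    case: yE => [[? ->]|[/andP[? ?] ->]|[? ->]]; split; lra.
have /andP[_ h] := lcdf_increment x0 xy' y1.
rewrite distrC ger0_norm ?subr_ge0 ?lcdf_homo //; apply: le_trans h _.
by rewrite ler_wpM2l ?(ltW b0) // distrC ger0_norm ?subr_ge0.
Qed.

Lemma continuous_lcdf : continuous (lcdf P).
Proof.
move=> x; apply/cvgrPdist_lt => e e0; near=> t.
apply: le_lt_trans (lcdf_lipschitz _ _) _.
rewrite mulrC -ltr_pdivlMr ?b0 //; near: t.
by apply: cvgr_dist_lt => //; rewrite divr_gt0 // b0.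
Unshelve. all: by end_near. Qed.

Lemma lcdf_surj (u : R) : 0 <= u <= 1 -> exists x, 0 <= x <= 1 /\ lcdf P x = u.
Proof.
move=> u01.
have [||x x01 <-] := @IVT R (lcdf P) 0 1 u ler01.
- exact/continuous_subspaceT/continuous_lcdf.
- by rewrite lcdf_le0 // lcdf1 min_l // max_r.
by exists x.
Qed.

End BoundedDensity.

(** For a bounded density and u in [0, 1] such a point exists and is unique; otherwise the default
    is 0. *)
Definition quantile (R : realType) (P : probability R R) (u : R) : R :=
  xget 0 [set x | 0 <= x <= 1 /\ lcdf P x = u].

Definition monotone_map (R : realType) (P Q : probability R R) (x : R) : R :=
  quantile Q (lcdf P x).

(** * The monotone rearrangement *)

Section MonotoneMap.
Variables (R : realType) (P Q : probability R R) (a b : R).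
Hypotheses (hP : bounded_density a b P) (hQ : bounded_density a b Q).
Local Notation T0 := (monotone_map P Q).

Lemma monotone_mapP x : 0 <= T0 x <= 1 /\ lcdf Q (T0 x) = lcdf P x.
Proof.
have [y Hy] := lcdf_surj hQ (lcdf01 P x).
by apply: (@xgetPex _ 0 [set z | 0 <= z <= 1 /\ lcdf Q z = lcdf P x]); exists y.
Qed.

Lemma monotone_map01 x : 0 <= T0 x <= 1.
Proof. by case: (monotone_mapP x). Qed.

Lemma lcdf_monotone_map x : lcdf Q (T0 x) = lcdf P x.
Proof. by case: (monotone_mapP x). Qed.

Lemma monotone_map_ltW x y : T0 x < T0 y -> x < y.
Proof.
have /andP[x0 _] := monotone_map01 x; have /andP[_ y1] := monotone_map01 y.
move=> xy; have := lcdf_lt hQ x0 xy y1.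
by rewrite !lcdf_monotone_map; apply: contraTT; rewrite -!leNgt => /(lcdf_homo P).
Qed.

Lemma monotone_map_homo x y : x <= y -> T0 x <= T0 y.
Proof. by rewrite !leNgt; apply: contra => /monotone_map_ltW. Qed.

Lemma monotone_map_lt x y : 0 <= x -> x < y -> y <= 1 -> T0 x < T0 y.
Proof.
move=> x0 xy y1; rewrite ltNge; apply: contraTN (lcdf_lt hP x0 xy y1).
by move=> /(lcdf_homo Q); rewrite !lcdf_monotone_map leNgt.
Qed.

Lemma measurable_monotone_map : measurable_fun setT T0.
Proof.
apply: nondecreasing_measurable => // x y; exact: monotone_map_homo.
Qed.

End MonotoneMap.

Section Transport.
Variables (R : realType) (P Q : probability R R) (a b : R).
Hypotheses (hP : bounded_density a b P) (hQ : bounded_density a b Q).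
Local Notation T0 := (monotone_map P Q).
Local Notation G := (monotone_map Q P).
Local Notation mu := (@lebesgue_measure R).

Lemma monotone_mapK x : 0 <= x <= 1 -> G (T0 x) = x.
Proof.
move=> x01; apply: (lcdf_inj hP) => //.
  exact: (monotone_map01 Q hP).
by rewrite (lcdf_monotone_map Q hP) (lcdf_monotone_map P hQ).
Qed.

(** On [0, 1] the two maps are increasing and inverse to each other. At y = 0 the equivalence would
    fail for x < 0, where [T0 x] is 0. *)
Lemma monotone_map_lt_iff x y : 0 < y <= 1 -> (T0 x < y) = (x < G y).
Proof.
move=> /andP[y0 y1].
have y01 : 0 <= y <= 1 by rewrite ltW.
have /andP[Gy0 Gy1] := monotone_map01 Q hP y.
have FG := lcdf_monotone_map Q hP y.
have FT := lcdf_monotone_map P hQ x.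
have /andP[T00 T01] := monotone_map01 P hQ x.
have Fy : 0 < lcdf Q y.
  by rewrite -(lcdf_le0 hQ (lexx 0)); apply: (lcdf_lt hQ).
have Gy : 0 < G y.
  rewrite lt_neqAle Gy0 andbT; apply: contraTneq Fy => Gy.
  by rewrite -FG -Gy (lcdf_le0 hP (lexx 0)) ltxx.
apply/idP/idP => h.
  rewrite ltNge; apply/negP => /(lcdf_homo P); rewrite FG -FT leNgt.
  by rewrite (lcdf_lt hQ T00 h y1).
rewrite ltNge; apply/negP => /(lcdf_homo Q); rewrite FT -FG leNgt.
have [x0|x0] := leP 0 x; first by rewrite (lcdf_lt hP x0 h Gy1).
by rewrite (lcdf_le0 hP (ltW x0)) FG Fy.
Qed.

Lemma lcdf_ltE x : P `]-oo, x[%classic = (lcdf P x)%:E.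
Proof. by rewrite /lcdf fineK ?fin_num_measure. Qed.

End Transport.

(** * Kantorovich potential and Young's inequality *)

Section Optimality.
Variables (R : realType) (P Q : probability R R) (a b : R).
Hypotheses (hP : bounded_density a b P) (hQ : bounded_density a b Q).
Local Notation T0 := (monotone_map P Q).
Local Notation G := (monotone_map Q P).
Local Notation mu := (@lebesgue_measure R).

Let T01 := monotone_map01 P hQ.
Let G01 := monotone_map01 Q hP.
Let T0K := monotone_mapK hP hQ.
Let GK := monotone_mapK hQ hP.

(** For y in (0, 1] the preimage of the half-line below y is the half-line below [G y], whose mass
    under [P] is [lcdf Q y]. *)
Lemma monotone_map_transports : transports P Q T0.
Proof.
have mT := measurable_monotone_map P hQ.
split => // A mA.
pose mT0 : {mfun _ >-> _} := HB.pack T0 (isMeasurableFun.Build _ _ _ _ _ mT).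
rewrite -/(distribution P mT0 A).
apply: probability_eq_lcdf => // y.
rewrite (lcdf_ltE Q) -[LHS]/(P (T0 @^-1` `]-oo, y[)).
have [y0|y0] := leP y 0.
  rewrite (lcdf_le0 hQ y0) (_ : _ @^-1` _ = set0) ?measure0 //.
  rewrite -subset0 => x /=; rewrite in_itv /=; have /andP[T00 _] := T01 x.
  by rewrite ltNge (le_trans y0 T00).
have [y1|y1] := leP y 1; last first.
  rewrite (lcdf_ge1 hQ (ltW y1)) (_ : _ @^-1` _ = setT).
    exact: probability_setT.
  apply/seteqP; split => // x _ /=; rewrite in_itv /=.
  by have /andP[_ Tx1] := T01 x; rewrite (le_lt_trans Tx1 y1).
rewrite (_ : _ @^-1` _ = `]-oo, G y[%classic).
  by rewrite (lcdf_ltE P) (lcdf_monotone_map Q hP).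
apply/seteqP; split => x /=; rewrite !in_itv /=.
  by rewrite (monotone_map_lt_iff hP hQ) // y0.
by rewrite (monotone_map_lt_iff hP hQ) // y0.
Qed.

(* This is the primitive of T0 vanishing at 0, because G t < s if and only if
   t < T0 s. *)
Definition potential (x : R) : R :=
  \int[mu]_(t in `[0, 1]) Num.max 0 (x - G t).

Let mu01 : mu `[0, 1] = 1%E.
Proof. by rewrite lebesgue_measure_itv /= lte_fin ltr01 oppr0 adde0. Qed.

Lemma integrable_bounded01 (h : R -> R) (M : R) : measurable_fun setT h ->
  (forall t, `|h t| <= M) -> mu.-integrable `[0, 1] (EFin \o h).
Proof.
move=> mh hM; apply: measurable_bounded_integrable => //.
- by rewrite [ltLHS]mu01 ltry.
- exact: measurable_funTS.
by exists M; split; [exact: num_real | move=> M' MM' x _; apply: le_trans (hM x) (ltW MM')].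
Qed.

Let mG := measurable_monotone_map Q hP.

Let mpos x : measurable_fun setT (fun t => Num.max 0 (x - G t)).
Proof. by apply: measurable_maxr => //; apply: measurable_funB. Qed.

Let ipos x : mu.-integrable `[0, 1] (EFin \o (fun t => Num.max 0 (x - G t))).
Proof.
apply: (@integrable_bounded01 _ (`|x|)) => // t.
have /andP[G0 _] := G01 t.
rewrite ger0_norm ?le_max ?lexx // ge_max normr_ge0 /=.
by apply: le_trans (ler_norm x); rewrite lerBlDr lerDl.
Qed.

(** The inequality holds under the integral sign: the indicator of t < T0 y is a subgradient, at y,
    of the positive part of y - G t, and its integral over [0, 1] is T0 y. *)
Lemma potential_subgradient x y : 0 <= y <= 1 ->
  potential y + T0 y * (x - y) <= potential x.
Proof.
move=> y01; have /andP[T00 T01'] := T01 y.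
pose step (t : R) : R := (x - y) * \1_(`]-oo, T0 y[) t.
have mstep : measurable_fun setT step.
  by apply: measurable_funM => //; apply: measurable_indic.
have istep : mu.-integrable `[0, 1] (EFin \o step).
  apply: (@integrable_bounded01 _ `|x - y|) => // t.
  rewrite /step normrM ler_piMr // indicE.
  by case: (_ \in _); rewrite ?normr1 ?normr0.
have -> : T0 y * (x - y) = \int[mu]_(t in `[0, 1]) step t.
  rewrite /Rintegral /step.
  under eq_integral do rewrite EFinM.
  rewrite integralZl; last 2 first.
  - by [].
  - apply: (@integrable_bounded01 _ 1) => [|t]; first exact: measurable_indic.
    by rewrite indicE; case: (_ \in _); rewrite ?normr1 ?normr0.
  rewrite integral_indic //.
  rewrite (_ : `]-oo, T0 y[ `&` `[0, 1] = `[0, T0 y[%classic).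
    rewrite [X in (_ * X)%E](_ : _ = (T0 y)%:E) ?[RHS]/= 1?mulrC //.
    have := lebesgue_measure_itv `[0, T0 y[ => /=; rewrite lte_fin => E.
    rewrite [LHS]E; case: ltP => h; first by rewrite oppr0 adde0.
    by congr (_%:E); apply/eqP; rewrite eq_le h T00.
  apply/seteqP; split => t /=; rewrite !in_itv /=.
    by move=> [-> /andP[-> _]].
  by move=> /andP[-> h]; rewrite h (ltW (lt_le_trans h T01')).
rewrite /potential -RintegralD //.
apply: le_Rintegral => //.
  exact: (integrableD _ (ipos y) istep).
move=> t; rewrite /= in_itv /= => /andP[t0 t1].
rewrite /step indicE; case: (ltP t (T0 y)) => tT.
  rewrite mem_set /= ?in_itv //.
  have Gty : G t <= y.
    rewrite -(T0K y01); apply: (monotone_map_homo _ hP); exact: ltW.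
  by rewrite mulr1 max_r ?subr_ge0 // le_max; apply/orP; right; lra.
rewrite memNset /= ?in_itv /=; last by rewrite ltNge tT.
have yGt : y <= G t.
  rewrite -(T0K y01); apply: (monotone_map_homo _ hP).
  exact: tT.
by rewrite mulr0 addr0 max_l ?subr_le0 // le_max lexx.
Qed.

(* Here y (G y) - phi (G y) is the Legendre transform of phi at y. *)
Definition young_gap (x y : R) : R :=
  potential x - potential (G y) - y * (x - G y).

Lemma young_gap_ge0 x y : 0 <= y <= 1 -> 0 <= young_gap x y.
Proof.
move=> y01; have := potential_subgradient x (G01 y).
by rewrite GK // /young_gap; lra.
Qed.

(* Strictness comes from the two subgradient inequalities at the midpoint of x
   and G y. *)
Lemma young_gap_eq0 x y : 0 <= x <= 1 -> 0 <= y <= 1 -> young_gap x y = 0 -> x = G y.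
Proof.
move=> /andP[x0 x1] y01; have /andP[g0 g1] := G01 y.
rewrite /young_gap => e.
pose h := (x + G y) / 2.
have h01 : 0 <= h <= 1 by rewrite /h; apply/andP; split; lra.
have s1 := potential_subgradient x h01.
have s2 := potential_subgradient h (G01 y).
rewrite GK // in s2.
have key : 0 <= (y - T0 h) * (x - h) by move: s1 s2 e; rewrite /h; lra.
have [xg|xg|//] := ltgtP x (G y).
  have : T0 h < T0 (G y).
    by apply: (monotone_map_lt hP hQ) => //; rewrite /h; lra.
  rewrite GK // => Th.
  have : 0 < (y - T0 h) * (h - x) by rewrite mulr_gt0 ?subr_gt0 // /h; lra.
  by move: key; lra.
have : T0 (G y) < T0 h.
  by apply: (monotone_map_lt hP hQ) => //; rewrite /h; lra.
rewrite GK // => Th.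
have : 0 < (T0 h - y) * (x - h) by rewrite mulr_gt0 ?subr_gt0 // /h; lra.
by move: key; lra.
Qed.

Lemma potential_homo x y : x <= y -> potential x <= potential y.
Proof.
move=> xy; apply: le_Rintegral => // t _; rewrite ge_max !le_max lexx /=.
by rewrite lerB ?orbT // lexx.
Qed.

Lemma measurable_potential : measurable_fun setT potential.
Proof.
by apply: nondecreasing_measurable => // x y; exact: potential_homo.
Qed.

End Optimality.

Section Clamp.
Variable R : realType.

(** Composing with this projection makes the functions below bounded, hence integrable, and changes
    nothing almost everywhere. *)
Definition clamp (x : R) : R := Num.max 0 (Num.min 1 x).

Lemma clamp01 x : 0 <= clamp x <= 1.
Proof. by rewrite /clamp le_max lexx ge_max ler01 ge_min lexx. Qed.

Lemma clamp_id x : 0 <= x <= 1 -> clamp x = x.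
Proof. by move=> /andP[x0 x1]; rewrite /clamp min_r // max_r. Qed.

Lemma measurable_clamp d (T : measurableType d) (h : T -> R) :
  measurable_fun setT h -> measurable_fun setT (clamp \o h).
Proof. by move=> mh; apply: measurable_maxr => //; apply: measurable_minr. Qed.

Lemma bounded_integrable d (T : measurableType d) (P : probability T R)
    (h : T -> R) (M : R) :
  measurable_fun setT h -> (forall t, `|h t| <= M) -> P.-integrable setT (EFin \o h).
Proof.
move=> mh hM; apply: measurable_bounded_integrable => //.
- by rewrite /= probability_setT ltry.
by exists M; split; [exact: num_real | move=> M' MM' x _; apply: le_trans (hM x) (ltW MM')].
Qed.

Lemma transports_Rintegral (P Q : probability R R) (S h : R -> R) (M : R) :
  transports P Q S -> measurable_fun setT h -> (forall t, `|h t| <= M) ->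
  \int[P]_x h (S x) = \int[Q]_y h y.
Proof.
move=> [mS PQ] mh hM.
pose X : {mfun _ >-> _} := HB.pack S (isMeasurableFun.Build _ _ _ _ _ mS).
rewrite /Rintegral; congr fine.
rewrite [RHS](eq_measure_integral (distribution P X)); last first.
  by move=> A mA _; exact/esym/PQ.
rewrite integral_distribution //; first by apply/measurable_EFinP.
apply: (@bounded_integrable _ _ _ _ M) => [|t]; last exact: hM.
exact: measurableT_comp.
Qed.

End Clamp.

(** * Identification of the optimal map *)

Section Optimality.
Variables (R : realType) (P Q : probability R R) (a b : R).
Hypotheses (hP : bounded_density a b P) (hQ : bounded_density a b Q).
Local Notation G := (monotone_map Q P).
Local Notation phi := (potential P Q).
Local Notation gap := (young_gap P Q).

Let G01 := monotone_map01 Q hP.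
Let mphi := measurable_potential Q hP.
Let mG := measurable_monotone_map Q hP.

Let phi_bounded x : 0 <= x <= 1 -> `|phi x| <= `|phi 0| + `|phi 1|.
Proof.
move=> /andP[x0 x1]; have h0 := potential_homo Q hP x0; have h1 := potential_homo Q hP x1.
rewrite ler_norml; apply/andP; split.
  by have := ler_norm (- phi 0); have := normr_ge0 (phi 1); rewrite normrN; lra.
by have := ler_norm (phi 1); have := normr_ge0 (phi 0); lra.
Qed.

(** On [0, 1] the square (x - y) ^ 2 is twice the Young gap plus [alpha] of x plus [beta] of y; [M]
    is a crude common bound for |alpha| and |beta|. *)
Let alpha x := clamp x ^+ 2 - 2 * phi (clamp x).
Let beta y := clamp y ^+ 2 - 2 * (clamp y * G (clamp y) - phi (G (clamp y))).
Let gap_of S x := gap (clamp x) (clamp (S x)).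
Let M := 1 + 2 * (1 + 2 * (`|phi 0| + `|phi 1|)).

Let mid_bound (x y : R) : 0 <= x <= 1 -> 0 <= y <= 1 -> `|x * y| <= 1.
Proof.
move=> /andP[x0 x1] /andP[y0 y1]; rewrite ger0_norm ?mulr_ge0 //.
by rewrite -[1]mulr1 ler_pM.
Qed.

Let alpha_bounded x : `|alpha x| <= M.
Proof.
have c := clamp01 x; have h := phi_bounded c; have := mid_bound c c.
rewrite -expr2 /alpha /M => h'; apply: le_trans (ler_normB _ _) _.
rewrite [`|2 * _|]normrM normr_nat; apply: lerD => //.
by have := normr_ge0 (phi 0); have := normr_ge0 (phi 1); lra.
Qed.

Let beta_bounded x : `|beta x| <= M.
Proof.
have c := clamp01 x; have h := phi_bounded (G01 (clamp x)); have := mid_bound c c.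
have h2 := mid_bound c (G01 (clamp x)).
rewrite -expr2 /beta /M => h'; apply: le_trans (ler_normB _ _) _.
rewrite [`|2 * _|]normrM normr_nat; apply: lerD => //.
rewrite ler_pM2l //; apply: le_trans (ler_normB _ _) _; apply: lerD => //.
by apply: le_trans h _; have := normr_ge0 (phi 0); have := normr_ge0 (phi 1); lra.
Qed.

Let malpha : measurable_fun setT alpha.
Proof.
have mc := measurable_clamp (@measurable_id _ R setT).
apply: measurable_funB; first exact: measurable_funX.
by apply: measurable_funM => //; exact: (measurableT_comp mphi mc).
Qed.

Let mGc : measurable_fun setT (G \o @clamp R).
Proof. exact: (measurableT_comp mG (measurable_clamp (@measurable_id _ R setT))). Qed.

Let mbeta : measurable_fun setT beta.
Proof.
have mc := measurable_clamp (@measurable_id _ R setT).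
apply: measurable_funB; first exact: measurable_funX.
apply: measurable_funM => //; apply: measurable_funB.
  by apply: measurable_funM => //; exact: mGc.
exact: (measurableT_comp mphi mGc).
Qed.

Let sqr_decomp S x : (clamp x - clamp (S x)) ^+ 2 =
  2 * gap_of S x + (alpha x + beta (S x)).
Proof. by rewrite /gap_of /young_gap /alpha /beta; ring. Qed.

Let mgap S : measurable_fun setT S -> measurable_fun setT (gap_of S).
Proof.
move=> mS; have mc := measurable_clamp (@measurable_id _ R setT).
apply: measurable_funB.
  apply: measurable_funB; first exact: (measurableT_comp mphi mc).
  exact: (measurableT_comp (measurableT_comp mphi mGc) mS).
apply: measurable_funM; first exact: measurable_clamp.
by apply: measurable_funB => //; exact: (measurableT_comp mGc mS).
Qed.

Lemma gap_of_ge0 S x : 0 <= gap_of S x.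
Proof. exact: (young_gap_ge0 hP hQ _ (clamp01 _)). Qed.

Let gap_bounded S x : `|gap_of S x| <= 1 + (M + M).
Proof.
have c := clamp01 x; have c' := clamp01 (S x).
have /ler_normlP[A1 A2] := alpha_bounded x; have /ler_normlP[B1 B2] := beta_bounded (S x).
have D := sqr_decomp S x.
have : (clamp x - clamp (S x)) ^+ 2 <= 1.
  rewrite -[1](expr1n _ 2) -(real_normK (num_real (_ - _))) ler_sqr ?nnegrE //.
  by rewrite ler_norml; lra.
have := gap_of_ge0 S x => g0.
by rewrite ger0_norm //; lra.
Qed.

Lemma transports_ae01 S : transports P Q S ->
  {ae P, forall x, 0 <= x < 1 /\ 0 <= S x < 1}.
Proof.
move=> [mS PQ].
have [N' [mN' N0' sN']] := ae_in01 hQ.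
have A2 : {ae P, forall x, 0 <= S x < 1}.
  exists (S @^-1` N'); split.
  - by rewrite -[X in measurable X]setTI; exact: mS.
  - by rewrite -N0'; exact: PQ.
  - by move=> x /= Sx; apply: sN'.
by apply: filterS2 (ae_in01 hP) A2 => x.
Qed.

Let igap S : measurable_fun setT S -> P.-integrable setT (EFin \o gap_of S).
Proof. by move=> mS; exact: bounded_integrable (mgap mS) (gap_bounded S). Qed.

(** The mean of [beta] at S x is its mean under [Q], whatever the transport map, so only the gap
    term depends on [S]. *)
Lemma quadratic_cost_decomp S : transports P Q S -> quadratic_cost P S =
  (2 * \int[P]_x gap_of S x + (\int[P]_x alpha x + \int[Q]_y beta y))%:E.
Proof.
move=> tS; have [mS _] := tS.
have mc := measurable_clamp (@measurable_id _ R setT).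
have mcS := measurable_clamp mS.
have mbS : measurable_fun setT (beta \o S) by exact: (measurableT_comp mbeta mS).
rewrite /quadratic_cost.
rewrite (@ae_eq_integral _ _ _ _ _ (fun x => ((clamp x - clamp (S x)) ^+ 2)%:E)) //; first last.
- apply: filterS (transports_ae01 tS) => x [/andP[x0 x1] /andP[S0 S1]] _.
  by rewrite !clamp_id // ?x0 ?S0 ltW.
- by apply/measurable_EFinP; apply: measurable_funX; apply: measurable_funB.
- by apply/measurable_EFinP; apply: measurable_funX; apply: measurable_funB.
under eq_integral do rewrite sqr_decomp.
have i1 : P.-integrable setT (EFin \o (fun x => 2 * gap_of S x)).
  apply: (@bounded_integrable _ _ _ _ _ (2 * (1 + (M + M)))).
    by apply: measurable_funM => //; exact: mgap.
  by move=> x; rewrite normrM normr_nat ler_pM2l.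
have ia := bounded_integrable P malpha alpha_bounded.
have ib := bounded_integrable P mbS (fun x => beta_bounded (S x)).
have i2 : P.-integrable setT (EFin \o (fun x => alpha x + beta (S x))).
  exact: (integrableD _ ia ib).
have i3 : P.-integrable setT
    (EFin \o (fun x => 2 * gap_of S x + (alpha x + beta (S x)))).
  exact: (integrableD _ i1 i2).
rewrite -[LHS]fineK ?integrable_fin_num //; congr (_%:E).
transitivity (\int[P]_x (2 * gap_of S x + (alpha x + beta (S x)))) => //.
have e1 := RintegralD measurableT i1 i2.
have e2 := RintegralD measurableT ia ib.
have e3 := RintegralZl 2 measurableT (igap mS).
have e4 := transports_Rintegral tS mbeta beta_bounded.
by rewrite e1 e3 -e4; congr (_ + _); exact: e2.
Qed.

Lemma lcdf_clamp x : lcdf P (clamp x) = lcdf P x.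
Proof.
have [x0|x0] := leP x 0.
  by rewrite (lcdf_le0 hP x0) (lcdf_le0 hP) // /clamp ge_max lexx ge_min x0 orbT.
have [x1|x1] := leP x 1; first by rewrite clamp_id // x1 ltW.
have -> : clamp x = 1 by rewrite /clamp (min_l (ltW x1)) max_r.
by rewrite !(lcdf_ge1 hP) // ltW.
Qed.

Lemma gap_monotone_map x : gap_of (monotone_map P Q) x = 0.
Proof.
rewrite /gap_of (clamp_id (monotone_map01 P hQ x)) /young_gap.
have -> : G (monotone_map P Q x) = clamp x.
  apply: (lcdf_inj hP) => //; first exact: clamp01.
  by rewrite (lcdf_monotone_map Q hP) (lcdf_monotone_map P hQ) lcdf_clamp.
by rewrite !subrr mulr0 subrr.
Qed.

(** The monotone map has gap 0, so by optimality the nonnegative gap of [T] has mean 0 and vanishes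
    almost everywhere; strictness in Young's inequality then yields x = G (T x). *)
Lemma optimal_map_lcdf T : optimal_transport_map P Q T ->
  {ae P, forall x, [/\ 0 <= x < 1, 0 <= T x < 1 & lcdf Q (T x) = lcdf P x]}.
Proof.
move=> [tT optT]; have [mT _] := tT.
have tT0 := monotone_map_transports hP hQ.
have := optT _ tT0; rewrite !quadratic_cost_decomp // lee_fin lerD2r ler_pM2l //.
have -> : \int[P]_x gap_of (monotone_map P Q) x = 0.
  by under eq_Rintegral do rewrite gap_monotone_map; rewrite /Rintegral integral0.
move=> gap0.
have gapE : (\int[P]_x `|(gap_of T x)%:E| = 0)%E.
  under eq_integral do rewrite abse_EFin ger0_norm ?gap_of_ge0 //.
  apply/eqP; rewrite eq_le integral_ge0 ?andbT; last first.
    by move=> x _; rewrite lee_fin gap_of_ge0.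
  rewrite -[leLHS]fineK ?lee_fin //.
  exact: (integrable_fin_num _ (igap mT)).
have mgT : measurable_fun setT (fun x => (gap_of T x)%:E).
  by apply/measurable_EFinP; exact: mgap.
have /(ae_eq_integral_abs P measurableT mgT) gae := gapE.
apply: filterS2 (transports_ae01 tT) gae => x [x01 T01] /(_ Logic.I) [].
have /andP[x0 x1] := x01; have /andP[T0 T1] := T01.
have x01' : 0 <= x <= 1 by rewrite x0 ltW.
have T01' : 0 <= T x <= 1 by rewrite T0 ltW.
rewrite /gap_of !clamp_id // => /(young_gap_eq0 hP hQ x01' T01') xE.
by split => //; rewrite [in RHS]xE (lcdf_monotone_map Q hP).
Qed.

End Optimality.

(** * The private estimator and its risk *)

Section Estimator.
Variables (R : realType) (n : nat) (eps : R).

(** The least L with n <= 2 ^ L: the grid step is at most 1 / n and the number of scales stays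
    logarithmic. *)
Definition depth : nat := up_log 2 n.

(** The successor keeps the denominator positive when the depth is 0. *)
Definition noise_rate : R := expR (- (eps / (4 * depth).+1%:R)).

Lemma noise_rate_gt0 : 0 < noise_rate.
Proof. exact: expR_gt0. Qed.

Definition private_map (k : nat) (x : R) : R :=
  transport_est (noisy_count (decode n depth k)) x.

(** The value depends only on the countable pair formed by the rank and the cell of x. *)
Lemma measurable_private_map :
  measurable_fun [set: nat * R] (fun zx => private_map zx.1 zx.2).
Proof.
pose h (c : nat * nat) : R := (\sum_(j < 2 ^ depth)
  (prefix_est (noisy_count (decode n depth c.1)) false j
   < prefix_est (noisy_count (decode n depth c.1)) true c.2)%N)%:R / (2 ^ depth)%:R.
rewrite (_ : (fun zx => _) = h \o (fun zx : nat * R => (zx.1, bin (2 ^ depth) zx.2))) //.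
apply: measurable_fun_countable => -[k i].
rewrite (_ : _ @^-1` _ = [set k] `*` (@bin R (2 ^ depth) @^-1` [set i])).
  by apply: measurableX => //; exact: measurable_bin_eq.
by apply/seteqP; split => -[k' x] /= [-> ->].
Qed.

Definition laplace_estimator : estimator R n :=
  @Estimator R n _ nat (laplace_mechanism (n := n) depth noise_rate_gt0) private_map
    measurable_private_map.

Lemma laplace_estimator_private : 0 < eps -> private_estimator eps laplace_estimator.
Proof.
move=> eps0 D D' _ _ nDD' A _ /=.
have q1 : noise_rate <= 1.
  by rewrite /noise_rate -expR0 ler_expR oppr_le0 divr_ge0 // ltW.
have := @laplace_mechanism_private R n depth _ noise_rate_gt0 _ _ A q1 nDD'.
move=> /(lee_wpmul2l _) h; apply: le_trans (h (expR eps)%:E _); last first.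
  by rewrite lee_fin expR_ge0.
rewrite muleA -EFinM -[leLHS]mul1e; apply: lee_wpmul2r => //.
(* What remains is that the privacy loss, eps times 4 L / (4 L + 1), is at most eps. *)
rewrite lee_fin /noise_rate -expRM_natl -expRD -[leLHS]expR0 ler_expR.
rewrite mulrN subr_ge0 mulrCA ler_piMr ?(ltW eps0) //.
by rewrite ler_pdivrMr ?ltr0n // mul1r ler_nat.
Qed.

End Estimator.

Lemma Lnorm2_sqr d (T : measurableType d) (R : realType) (P : probability T R)
    (h : T -> R) : (('N[P]_(2%:E)[EFin \o h]) ^+ 2 = \int[P]_x ((h x) ^+ 2)%:E)%E.
Proof.
have E : (Lnorm P 2%:E (EFin \o h) `^ 2 = \int[P]_x ((h x) ^+ 2)%:E)%E.
  rewrite poweR_Lnorm //; apply: eq_integral => x _.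
  by rewrite abse_EFin poweR_EFin powR_mulrn // real_normK ?num_real.
rewrite -E; have := Lnorm_ge0 P 2%:E (EFin \o h).
case: (Lnorm _ _ _) => [r| |] //=.
  by rewrite lee_fin => r0; rewrite powR_mulrn // EFin_expe.
by move=> _; rewrite mulyy pnatr_eq0.
Qed.

Lemma lcdf_bin (R : realType) (a b : R) (P : probability R R) (m i : nat) :
  bounded_density a b P -> (0 < m)%N ->
  fine (P [set x | (bin m x < i)%N]) = lcdf P (i%:R / m%:R).
Proof.
move=> hP m0; case: i => [|i].
  (* At i = 0 the two sets differ, one being empty and the other the negative half-line, but both
     have mass 0. *)
  rewrite mul0r (lcdf_le0 hP) // (_ : [set x | _] = set0) ?measure0 //.
  by rewrite -subset0.
congr (fine (P _)); apply/seteqP; split => x /=;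
  by rewrite bin_ltn in_itv /= ltr_pdivlMr ?ltr0n // mulrC.
Qed.

Section RiskIntegral.
Context d (Omega : measurableType d) (R : realType) (Pr : probability Omega R).

Lemma integral_affine_le (I : finType) (c v : R) (k : I -> R) (u : I -> Omega -> R) :
  0 <= c -> (forall i, 0 <= k i) -> (forall i w, 0 <= u i w) ->
  (forall i, measurable_fun setT (u i)) ->
  (forall i, (\int[Pr]_w (u i w)%:E <= v%:E)%E) ->
  (\int[Pr]_w (c + \sum_i k i * u i w)%:E <= (c + \sum_i k i * v)%:E)%E.
Proof.
move=> c0 k0 u0 mu uv.
have mku i : measurable_fun setT (fun w => (k i * u i w)%:E).
  by apply/measurable_EFinP; exact: measurable_funM.
under eq_integral do rewrite EFinD.
rewrite ge0_integralD //; first last.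
- by apply/measurable_EFinP; apply: measurable_sum => i; exact: measurable_funM.
- by move=> w _; rewrite lee_fin sumr_ge0 // => i _; rewrite mulr_ge0.
rewrite integral_cst //= probability_setT mule1 EFinD leeD2l //.
under eq_integral do rewrite -sumEFin.
rewrite ge0_integral_sum //; last by move=> i w _; rewrite lee_fin mulr_ge0.
rewrite -sumEFin; apply: lee_sum => i _.
under eq_integral do rewrite EFinM.
rewrite ge0_integralZl_EFin //; last first.
- exact/measurable_EFinP.
- by move=> w _; rewrite lee_fin.
by rewrite EFinM lee_wpmul2l // lee_fin.
Qed.

End RiskIntegral.

(** This is [risk_bound] with each squared sampling error replaced by 1 / n and the sum of the
    weights by 2 (L + 1). *)
Definition risk_const (R : realType) (n L : nat) (q a b : R) : R :=
  2 * (2 ^ L)%:R^-1 ^+ 2 + 4 * L.+1%:R / a ^+ 2 * (2 * L.+1%:R *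
    (3 * (4 * noise_level n L q + 4 / n%:R + ((b + 2 * a) / (2 ^ L)%:R) ^+ 2))).

(** * Mean risk over samples and noise *)

Section Risk.
Variables (R : realType) (n : nat).
Context d (Omega : measurableType d) (Pr : probability Omega R).
Variables (X Y : 'I_n -> {RV Pr >-> R}) (PX PY : probability R R) (a b : R).
Hypotheses (n0 : (0 < n)%N) (XY : iid_two_samples X Y PX PY).
Hypotheses (hX : bounded_density a b PX) (hY : bounded_density a b PY).

Let a0 : 0 < a. Proof. by case: hX. Qed.

Let b0 : 0 <= b. Proof. by case: hX => ? ab _; rewrite ltW // (lt_trans _ ab). Qed.

Lemma measurable_binned_sample (L : nat) B :
  measurable ((fun w => binned L (sample_data X Y w)) @^-1` [set B]).
Proof.
have mD : measurable_fun setT (fun w => sample_data X Y w : (n.-tuple R * n.-tuple R)%type).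
  apply/measurable_fun_pair; apply/measurable_fun_tnthP => i.
    rewrite (_ : _ \o _ = X i) //.
    by apply/funext => w /=; rewrite tnth_mktuple.
  rewrite (_ : _ \o _ = Y i) //.
  by apply/funext => w /=; rewrite tnth_mktuple.
by have := mD measurableT _ (@measurable_binned R n L B); rewrite setTI.
Qed.

Lemma noise_level_ge0 L (q : R) : 0 <= noise_level n L q.
Proof.
apply: divr_ge0; last exact: sqr_ge0.
by apply: mulr_ge0; [exact: sqr_ge0 | apply: divr_ge0 => //; exact: sqr_ge0].
Qed.

Lemma expected_risk_bound (L : nat) (q : R) (i r : nat) : (r <= 2 ^ L)%N ->
  (\int[Pr]_w (risk_bound L q a b (binned L (sample_data X Y w))
     (lcdf PX) (lcdf PY) i r)%:E <= (risk_const n L q a b)%:E)%E.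
Proof.
move=> rL; have m0 : (0 < 2 ^ L)%N by rewrite expn_gt0.
pose B w := binned L (sample_data X Y w).
pose N := noise_level n L q; have N0 : 0 <= N by exact: noise_level_ge0.
pose be : R := ((b + 2 * a) / (2 ^ L)%:R) ^+ 2.
pose A : R := 4 * L.+1%:R / a ^+ 2.
have A0 : 0 <= A by rewrite divr_ge0 ?sqr_ge0.
pose k (j : 'I_(2 ^ L)) : R := ((ndist j r).+1%:R)^-1.
have k0 j : 0 <= k j by rewrite invr_ge0.
pose p (P : probability R R) (j : nat) := lcdf P (j%:R / (2 ^ L)%:R).
pose u (j : 'I_(2 ^ L)) w := cdf_sqr_error (B w) false j (p PY j)
  + cdf_sqr_error (B w) true i (p PX i).
have mcdf s j t : measurable_fun setT (fun w => cdf_sqr_error (B w) s j t).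
  exact: (measurable_fun_countable (fun B => cdf_sqr_error B s j t)
    (@measurable_binned_sample L)).
have cdf_le s j : (\int[Pr]_w (cdf_sqr_error (B w) s j
    (p (if s then PX else PY) j))%:E <= (n%:R^-1)%:E)%E.
  have := expected_cdf_sqr_error L n0 XY s j; rewrite /p.
  by case: s => /=; rewrite ?(lcdf_bin _ hX m0) ?(lcdf_bin _ hY m0).
(* The risk bound is affine in the squared sampling errors; [c] gathers the terms that do not depend
   on the sample. *)
pose c := 2 * (2 ^ L)%:R^-1 ^+ 2 + \sum_j A * k j * (3 * (4 * N + be)).
have c0 : 0 <= c.
  rewrite addr_ge0 ?mulr_ge0 ?sqr_ge0 //; apply: sumr_ge0 => j _.
  apply: mulr_ge0; first exact: mulr_ge0 A0 (k0 j).
  by apply: mulr_ge0 => //; rewrite addr_ge0 ?sqr_ge0 // mulr_ge0.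
have E w : risk_bound L q a b (B w) (lcdf PX) (lcdf PY) i r =
    c + \sum_j (A * k j * 6) * u j w.
  rewrite /risk_bound -/A /c -addrA -big_split mulr_sumr /=; congr (_ + _).
  by apply: eq_bigr => j _; rewrite -/(k j) -/be /u /p /N; ring.
under eq_integral do rewrite -/(B _) E.
apply: le_trans (integral_affine_le (v := 2 / n%:R) c0 _ _ _ _) _.
- by move=> j; apply: mulr_ge0 => //; exact: mulr_ge0 A0 (k0 j).
- by move=> j w; rewrite addr_ge0 ?sqr_ge0.
- by move=> j; apply: measurable_funD.
- move=> j; rewrite /u; under eq_integral do rewrite EFinD.
  rewrite ge0_integralD //; first last.
  + by apply/measurable_EFinP.
  + by move=> w _; rewrite lee_fin sqr_ge0.
  + by apply/measurable_EFinP.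
  + by move=> w _; rewrite lee_fin sqr_ge0.
  rewrite mulr_natl mulr2n EFinD; apply: leeD; first exact: (cdf_le false).
  exact: (cdf_le true).
rewrite lee_fin /risk_const /c -addrA lerD2l -/N -/be -/A.
rewrite -big_split /=.
rewrite (eq_bigr (fun j => A * (k j * (3 * (4 * N + 4 / n%:R + be))))); last first.
  by move=> j _; ring.
rewrite -mulr_sumr ler_wpM2l // -mulr_suml ler_wpM2r //; last exact: sum_inv_ndist_le.
by rewrite mulr_ge0 // !addr_ge0 ?sqr_ge0 ?divr_ge0 // mulr_ge0.
Qed.

Variables (T : R -> R) (eps : R).
Hypotheses (eps0 : 0 < eps) (optT : optimal_transport_map PX PY T).
Local Notation L := (depth n).
Local Notation q := (noise_rate n eps).
Local Notation Z := {ffun bool * 'I_L * 'I_(2 ^ L) -> 'I_n.+1}.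

Let rb (B : {ffun bool * 'I_n -> nat}) (x : R) : R :=
  risk_bound L q a b B (lcdf PX) (lcdf PY) (bin (2 ^ L) x) (bin (2 ^ L) (T x)).

Lemma risk_bound_ge0 B F G i r : 0 <= @risk_bound R n L q a b B F G i r.
Proof.
have N0 := noise_level_ge0 L q.
rewrite /risk_bound; apply: addr_ge0; first by rewrite mulr_ge0 ?sqr_ge0.
apply: mulr_ge0; first by rewrite divr_ge0 ?sqr_ge0.
apply: sumr_ge0 => j _; apply: mulr_ge0; first by rewrite invr_ge0.
apply: mulr_ge0 => //; rewrite addr_ge0 ?sqr_ge0 //.
by rewrite !addr_ge0 // mulr_ge0 ?sqr_ge0.
Qed.

Let noise_rate_lt1 : q < 1.
Proof.
by rewrite /noise_rate -expR0 ltr_expR oppr_lt0 divr_gt0.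
Qed.

Let mT : measurable_fun setT T.
Proof. by case: optT => -[]. Qed.

Lemma measurable_bin (m : nat) (h : R -> R) i : measurable_fun setT h ->
  measurable ((fun x => bin m (h x)) @^-1` [set i]).
Proof.
move=> mh; have := mh measurableT _ (measurable_bin_eq m i).
by rewrite setTI.
Qed.

Lemma measurable_sample_bins c :
  measurable ((fun wx : Omega * R => (binned L (sample_data X Y wx.1),
    bin (2 ^ L) wx.2, bin (2 ^ L) (T wx.2))) @^-1` [set c]).
Proof.
case: c => -[B i] r.
rewrite (_ : _ @^-1` _ = ((fun w => binned L (sample_data X Y w)) @^-1` [set B])
  `*` (((fun x => bin (2 ^ L) x) @^-1` [set i]) `&`
       ((fun x => bin (2 ^ L) (T x)) @^-1` [set r]))).
  apply: measurableX; first exact: measurable_binned_sample.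
  by apply: measurableI; apply: measurable_bin.
apply/seteqP; split => -[w x] /=; first by case=> -> -> ->.
by case=> -> [-> ->].
Qed.

(** Since F_Y (T x) = F_X x and x lies at most one grid step above its grid point, the upper slope b
    gives the slack required by [conditional_risk]. *)
Lemma ae_conditional_risk B : {ae PX, forall x,
  \sum_(z : Z) laplace_pmf q (cell_count B) z *
    (transport_est (noisy_count z) x - T x) ^+ 2 <= rb B x}.
Proof.
apply: filterS (optimal_map_lcdf hX hY optT) => x [/andP[x0 x1] /andP[T0 T1] FT].
have m0 : (0 < 2 ^ L)%N by rewrite expn_gt0.
have mR : 0 < (2 ^ L)%:R :> R by rewrite ltr0n.
have /andP[i1 i2] : (bin (2 ^ L) x)%:R <= (2 ^ L)%:R * x < (bin (2 ^ L) x).+1%:R.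
  by rewrite /bin truncn_itv // mulr_ge0 // ltW.
apply: conditional_risk => //.
- exact: noise_rate_gt0.
- by rewrite T0 ltW.
- by move=> y y' y0 yy' y1; case/andP: (lcdf_increment hY y0 yy' y1).
- rewrite -(ltr_nat R); apply: le_lt_trans i1 _.
  by rewrite -[ltRHS]mulr1 ltr_pM2l.
have iR0 : 0 <= (bin (2 ^ L) x)%:R / (2 ^ L)%:R :> R by rewrite divr_ge0 // ltW.
have ix : (bin (2 ^ L) x)%:R / (2 ^ L)%:R <= x by rewrite ler_pdivrMr // mulrC.
have /andP[] := lcdf_increment hX iR0 ix (ltW x1).
rewrite FT => h1 h2; rewrite (lcdf_homo PX ix) /= -lerBlDl; apply: le_trans h2 _.
rewrite ler_wpM2l // lerBlDl -[X in _ + X]mul1r -mulrDl natr1 ler_pdivlMr // mulrC.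
exact: ltW.
Qed.

Lemma L2_risk_le : (L2_risk X Y (laplace_estimator n eps) PX T
  <= (risk_const n L q a b)%:E)%E.
Proof.
pose N2 k : \bar R := (\int[PX]_x ((private_map n k x - T x) ^+ 2)%:E)%E.
pose B w := binned L (sample_data X Y w).
have N20 k : (0 <= N2 k)%E by apply: integral_ge0 => x _; rewrite lee_fin sqr_ge0.
have mpm k : measurable_fun setT (private_map n k : R -> R).
  have := measurableT_comp (@measurable_private_map R n)
    (measurable_fun_pair (measurable_cst k) (@measurable_id _ R setT)).
  by [].
have inner w : (\int[mechanism (laplace_estimator n eps) (sample_data X Y w)]_z
     ('N[PX]_(2%:E)[EFin \o (estimate (e := laplace_estimator n eps) z \- T)%R]) ^+ 2 =
   \sum_(k < #|{: Z}|) (laplace_pmf q (cell_count (B w)) (decode n L k))%:E * N2 k)%E.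
  under eq_integral do rewrite Lnorm2_sqr.
  exact: (@integral_laplace_mechanism R n L q (noise_rate_gt0 n eps) (sample_data X Y w) N2 N20).
(* For fixed data the sum over outputs moves inside the integral over x, where the conditional bound
   holds almost everywhere. *)
have inner_le w : (\sum_(k < #|{: Z}|)
    (laplace_pmf q (cell_count (B w)) (decode n L k))%:E * N2 k
    <= \int[PX]_x (rb (B w) x)%:E)%E.
  have p0 k : 0 <= laplace_pmf q (cell_count (B w)) (decode n L k).
    exact/laplace_pmf_ge0/noise_rate_gt0.
  have msq k : measurable_fun setT (fun x => ((private_map n k x - T x) ^+ 2)%:E).
    by apply/measurable_EFinP; apply: measurable_funX; apply: measurable_funB.
  have msum : measurable_fun setT (fun x => \sum_(k < #|{: Z}|)
      (laplace_pmf q (cell_count (B w)) (decode n L k) *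
       (private_map n k x - T x) ^+ 2)).
    apply: measurable_sum => k; apply: measurable_funM => //.
    by apply: measurable_funX; apply: measurable_funB.
  rewrite (eq_bigr (fun k : 'I_#|{: Z}| => \int[PX]_x
    (laplace_pmf q (cell_count (B w)) (decode n L k) *
       (private_map n k x - T x) ^+ 2)%:E)%E); last first.
    move=> k _; under [RHS]eq_integral do rewrite EFinM.
    rewrite ge0_integralZl_EFin // => x _; by rewrite lee_fin sqr_ge0.
  rewrite -ge0_integral_sum //; last 2 first.
  - by move=> k; apply/measurable_EFinP; apply: measurable_funM => //;
      apply: measurable_funX; apply: measurable_funB.
  - by move=> k x _; rewrite lee_fin mulr_ge0 ?sqr_ge0.
  under eq_integral do rewrite sumEFin.
  apply: ae_ge0_le_integral => //.
  - move=> x _; rewrite lee_fin; apply: sumr_ge0 => k _.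
    by rewrite mulr_ge0 ?sqr_ge0.
  - exact/measurable_EFinP.
  - by move=> x _; rewrite lee_fin risk_bound_ge0.
  - have mb c : measurable ((fun x => (bin (2 ^ L) x, bin (2 ^ L) (T x))) @^-1` [set c]).
      case: c => i r; rewrite (_ : _ @^-1` _ = ((fun x => bin (2 ^ L) x) @^-1` [set i]) `&`
         ((fun x => bin (2 ^ L) (T x)) @^-1` [set r])).
        by apply: measurableI; apply: measurable_bin.
      by apply/seteqP; split => x /= [-> ->].
    exact: (measurable_fun_countable (fun c : nat * nat => (risk_bound L q a b (B w)
      (lcdf PX) (lcdf PY) c.1 c.2)%:E) mb).
  apply: filterS (ae_conditional_risk (B w)) => x h _; rewrite lee_fin.
  apply: le_trans h.
  by rewrite (@big_decode n L _ _ _ (fun z : Z => laplace_pmf q (cell_count (B w)) z *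
    (transport_est (noisy_count z) x - T x) ^+ 2)).
rewrite /L2_risk; under eq_integral do rewrite inner.
have mrb : measurable_fun setT (fun wx : Omega * R => (rb (B wx.1) wx.2)%:E).
  exact: (measurable_fun_countable (fun c : {ffun bool * 'I_n -> nat} * nat * nat =>
    (risk_bound L q a b c.1.1 (lcdf PX) (lcdf PY) c.1.2 c.2)%:E)
    measurable_sample_bins).
apply: le_trans (_ : (\int[Pr]_w \int[PX]_x (rb (B w) x)%:E <= _)%E).
  apply: ge0_le_integral => //.
  - by move=> w _; apply: sume_ge0 => k _; rewrite mule_ge0 // lee_fin
      laplace_pmf_ge0 // noise_rate_gt0.
  - exact: (measurable_fun_countable (fun B => \sum_(k < #|{: Z}|)
      (laplace_pmf q (cell_count B) (decode n L k))%:E * N2 k)%E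
      (@measurable_binned_sample L)).
  - exact: (measurable_fun_countable (fun B => \int[PX]_x (rb B x)%:E)%E
      (@measurable_binned_sample L)).
(* By Tonelli the sampling error is averaged at a fixed x, for which both grid indices are
   constants. *)
rewrite (fubini_tonelli (fun wx : Omega * R => (rb (B wx.1) wx.2)%:E)) //=; last first.
  by move=> wx; rewrite lee_fin risk_bound_ge0.
apply: le_trans (_ : (\int[PX]_x (risk_const n L q a b)%:E <= _)%E); last first.
  by rewrite integral_cst //= probability_setT mule1.
apply: ae_ge0_le_integral => //.
- by move=> x _; apply: integral_ge0 => w _; rewrite lee_fin risk_bound_ge0.
- apply: (@measurable_fun_fubini_tonelli_G _ _ _ _ _ Pr
    (fun wx : Omega * R => (rb (B wx.1) wx.2)%:E)) => //.
  by move=> wx; rewrite lee_fin risk_bound_ge0.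
- move=> x _; rewrite lee_fin; apply: addr_ge0; first by rewrite mulr_ge0 ?sqr_ge0.
  apply: mulr_ge0; first by rewrite divr_ge0 ?sqr_ge0.
  apply: mulr_ge0; first by rewrite mulr_ge0.
  apply: mulr_ge0 => //; apply: addr_ge0; last exact: sqr_ge0.
  by apply: addr_ge0; [exact: mulr_ge0 (noise_level_ge0 L q) | exact: divr_ge0].
apply: filterS (optimal_map_lcdf hX hY optT) => x [_ /andP[T0 T1] _] _.
apply: expected_risk_bound; rewrite /bin truncn_le_nat.
apply: lt_trans (_ : (2 ^ L)%:R < _); last by rewrite ltr_nat.
by rewrite -[ltRHS]mulr1 ltr_pM2l // ltr0n expn_gt0.
Qed.

End Risk.

(** * From the explicit bound to the rate *)

Section Rate.
Variable R : realType.

Lemma half_le_ln2 : 2^-1 <= ln 2 :> R.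
Proof.
have h : expR (2^-1) <= 2 :> R.
  rewrite -[expR _]invrK -expRN -[leRHS]invrK lef_pV2 ?posrE ?expR_gt0 ?invr_gt0 //.
  by apply: le_trans (expR_ge1Dx _); lra.
by rewrite -ler_expR lnK ?posrE.
Qed.

(** Minimality of L gives 2 ^ (L - 1) < n, and ln 2 is at least 1 / 2. *)
Lemma depth_le (n : nat) : (1 < n)%N -> (depth n).+1%:R <= 2 * (1 + ln n%:R) :> R.
Proof.
move=> n1; have := up_log_gtn (isT : 1 < 2)%N n1; rewrite -/(depth n).
have : (0 < depth n)%N by rewrite /depth up_log_gt0.
case: (depth n) => // l _ /=; rewrite -(ltr_nat R) natrX => h.
have h' : ln (2 ^+ l) <= ln n%:R :> R.
  by rewrite ler_ln ?posrE ?exprn_gt0 ?ltr0n ?(ltnW n1) // ltW.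
rewrite lnXn // in h'.
have := half_le_ln2; have l0 : 0 <= l%:R :> R by [].
move: h'; rewrite -mulr_natl -[l.+2%:R]natr1 -[l.+1%:R]natr1.
by move=> h1 h2; have := ler_wpM2l l0 h2; lra.
Qed.

(** With lam = eps / (4 L + 1), the bound exp (- lam) <= 1 / (1 + lam) gives 1 - q >= lam / (1 +
    lam). *)
Lemma inv_noise_rate_le (n : nat) (eps : R) : 0 < eps ->
  (1 - noise_rate n eps)^-1 <= 1 + (4 * depth n).+1%:R / eps.
Proof.
move=> eps0; set K := (4 * depth n).+1%:R; have K0 : 0 < K by rewrite ltr0n.
set lam := eps / K; have l0 : 0 < lam by rewrite divr_gt0.
have q_le : noise_rate n eps <= (1 + lam)^-1.
  by rewrite /noise_rate expRN lef_pV2 ?posrE ?expR_gt0 ?addr_gt0 // expR_ge1Dx.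
have -> : 1 + K / eps = (1 - (1 + lam)^-1)^-1.
  have -> : 1 - (1 + lam)^-1 = lam / (1 + lam) by field; rewrite gt_eqF ?addr_gt0.
  by rewrite invf_div /lam; field; rewrite !gt_eqF.
have i1 : (1 + lam)^-1 < 1 by rewrite invf_lt1 ?ltrDl ?addr_gt0.
by rewrite lef_pV2 ?posrE ?subr_gt0 ?lerD2l ?lerN2 // (le_lt_trans q_le).
Qed.

(** Since 4 L + 1 <= 4 (L + 1), the factor 4 / (1 - q) ^ 2 is at most 8 + 128 (L + 1) ^ 2 / eps ^ 2,
    and 136 = 8 + 128. *)
Lemma noise_level_le (n : nat) (eps v : R) : 0 < eps -> (0 < n)%N ->
  n%:R^-1 <= v -> (n%:R ^+ 2 * eps ^+ 2)^-1 <= v ->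
  noise_level n (depth n) (noise_rate n eps) <= 136 * (depth n).+1%:R ^+ 4 * v.
Proof.
move=> eps0 n0 v1 v2; have nR : 1 <= n%:R :> R by rewrite ler1n.
have n_gt0 : 0 < n%:R :> R by rewrite ltr0n.
have inv0 : 0 <= (1 - noise_rate n eps)^-1.
  by rewrite invr_ge0 subr_ge0 -expR0 ler_expR oppr_le0 divr_ge0 // ltW.
have := inv_noise_rate_le n eps0; rewrite /noise_level.
set L := depth n; set q := noise_rate n eps in inv0 *; set K := (4 * L).+1%:R => hq.
set l : R := L.+1%:R.
have l1 : 1 <= l by rewrite ler1n.
have L0 : 0 <= L%:R :> R by [].
have Ll : L%:R <= l by rewrite ler_nat.
have K0 : 0 <= K by [].
have Kl : K <= 4 * l.
  have : ((4 * L).+1 <= 4 * L.+1)%N by rewrite mulnS -add1n leq_add2r.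
  by rewrite -(ler_nat R) natrM.
have hq2 : (1 - q)^-1 ^+ 2 <= 2 + 2 * (K ^+ 2 / eps ^+ 2).
  apply: le_trans (_ : (1 + K / eps) ^+ 2 <= _).
    by rewrite ler_sqr ?nnegrE // addr_ge0 // divr_ge0 // ltW.
  have -> : K ^+ 2 / eps ^+ 2 = (K / eps) ^+ 2 by rewrite exprMn exprVn.
  by have := sqr_ge0 (1 - K / eps); rewrite !expr2; lra.
have e2 : 0 < eps ^+ 2 by rewrite exprn_gt0.
have w2 : 0 <= (n%:R ^+ 2 * eps ^+ 2)^-1 by rewrite invr_ge0 mulr_ge0 // sqr_ge0.
have v0 : 0 <= v by apply: le_trans v2.
have v3 : n%:R ^- 2 <= v.
  apply: le_trans v1; rewrite lef_pV2 ?posrE ?exprn_gt0 //.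
  by rewrite expr2 ler_pMr.
have L2 : L%:R ^+ 2 <= l ^+ 2 by rewrite ler_sqr ?nnegrE // (le_trans _ l1).
have K2 : K ^+ 2 <= 16 * l ^+ 2.
  have -> : 16 * l ^+ 2 = (4 * l) ^+ 2 by ring.
  by rewrite ler_sqr ?nnegrE // mulr_ge0 // (le_trans _ l1).
have l24 : l ^+ 2 <= l ^+ 4 by apply: ler_weXn2l.
have l20 : 0 <= l ^+ 2 by exact: sqr_ge0.
apply: le_trans (_ : l ^+ 2 * (4 * (2 + 2 * (16 * l ^+ 2 / eps ^+ 2))) / n%:R ^+ 2 <= _).
  rewrite ler_wpM2r ?invr_ge0 ?sqr_ge0 //; apply: ler_pM => //.
  - by rewrite divr_ge0 // sqr_ge0.
  rewrite ler_wpM2l // -exprVn; apply: le_trans hq2 _.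
  by rewrite lerD2l ler_wpM2l // ler_wpM2r // invr_ge0 ltW.
have -> : l ^+ 2 * (4 * (2 + 2 * (16 * l ^+ 2 / eps ^+ 2))) / n%:R ^+ 2 =
    8 * l ^+ 2 * n%:R ^- 2 + 128 * l ^+ 4 * (n%:R ^+ 2 * eps ^+ 2)^-1.
  by field; rewrite !gt_eqF.
have -> : 136 * l ^+ 4 * v = 8 * l ^+ 4 * v + 128 * l ^+ 4 * v by ring.
apply: lerD; last by rewrite ler_wpM2l // mulr_ge0 // exprn_ge0 // (le_trans _ l1).
apply: ler_pM => //; first by rewrite mulr_ge0.
by rewrite ler_wpM2l.
Qed.

(** Here 548 = 4 * 136 + 4 collects noise and sampling, 24 = 4 * 2 * 3 comes from [risk_const], and
    64 = 2 ^ 6 from [depth_le]. *)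
Definition rate_const (a b : R) : R :=
  64 * (2 + 24 / a ^+ 2 * (548 + (b + 2 * a) ^+ 2)).

Lemma rate_const_gt0 (a b : R) : 0 < rate_const a b.
Proof.
apply: mulr_gt0; first by rewrite ltr0n.
apply: ltr_pwDl; first by rewrite ltr0n.
apply: mulr_ge0; first by apply: divr_ge0; [exact: ler0n | exact: sqr_ge0].
by apply: addr_ge0; [exact: ler0n | exact: sqr_ge0].
Qed.

(** The sixth power splits into (L + 1) ^ 4 from the noise level and (L + 1) ^ 2 from Cauchy-Schwarz
    with the weights. *)
Lemma risk_const_le (n : nat) (eps a b : R) : 0 < eps -> (1 < n)%N ->
  0 < a -> 0 <= b ->
  risk_const n (depth n) (noise_rate n eps) a b <=
  rate_const a b * (1 + ln n%:R) ^+ 6 *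
    Num.max n%:R^-1 ((n%:R ^+ 2 * eps ^+ 2)^-1).
Proof.
move=> eps0 n1 a0 b0; have n0 : (0 < n)%N by exact: ltnW.
have nR : 1 <= n%:R :> R by rewrite ler1n.
have n_gt0 : 0 < n%:R :> R by rewrite ltr0n.
set v := Num.max _ _.
have v1 : n%:R^-1 <= v by rewrite le_max lexx.
have v2 : (n%:R ^+ 2 * eps ^+ 2)^-1 <= v by rewrite le_max lexx orbT.
have v0 : 0 <= v by apply: le_trans v1; rewrite invr_ge0 ltW.
have := noise_level_le eps0 n0 v1 v2.
have := depth_le n1; have := up_logP n (isT : 1 < 2)%N; rewrite -/(depth n).
rewrite /risk_const; set N := noise_level _ _ _; set L := depth n.
set l : R := L.+1%:R; set mi : R := (2 ^ L)%:R^-1 => nm lln hN.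
have l1 : 1 <= l by rewrite ler1n.
have mi0 : 0 <= mi by rewrite invr_ge0.
have mi1 : mi <= n%:R^-1.
  by rewrite /mi lef_pV2 ?posrE ?ltr0n ?expn_gt0 // ler_nat.
have mi2 : mi ^+ 2 <= v.
  apply: le_trans v1; rewrite expr2 -[leRHS]mulr1; apply: ler_pM => //.
  by apply: le_trans mi1 _; rewrite invf_le1.
have l4 : 1 <= l ^+ 4 by rewrite exprn_ege1.
have l6 : 1 <= l ^+ 6 by rewrite exprn_ege1.
have v4 : v <= l ^+ 4 * v by rewrite ler_peMl.
have v6 : v <= l ^+ 6 * v by rewrite ler_peMl.
have hS : 4 * N + 4 / n%:R + ((b + 2 * a) * mi) ^+ 2 <=
    (548 + (b + 2 * a) ^+ 2) * (l ^+ 4 * v).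
  rewrite exprMn; have be0 := sqr_ge0 (b + 2 * a).
  have h1 := ler_wpM2l be0 (le_trans mi2 v4).
  rewrite [leRHS]mulrDl; apply: lerD => //.
  by rewrite -mulrA in hN; lra.
apply: le_trans (_ : (2 + 24 / a ^+ 2 * (548 + (b + 2 * a) ^+ 2)) * (l ^+ 6 * v) <= _).
  rewrite [leRHS]mulrDl; apply: lerD.
    by rewrite ler_wpM2l // (le_trans mi2).
  have -> : 4 * l / a ^+ 2 * (2 * l * (3 * (4 * N + 4 / n%:R + ((b + 2 * a) * mi) ^+ 2)))
    = 24 / a ^+ 2 * l ^+ 2 * (4 * N + 4 / n%:R + ((b + 2 * a) * mi) ^+ 2) by ring.
  have -> : 24 / a ^+ 2 * (548 + (b + 2 * a) ^+ 2) * (l ^+ 6 * v) =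
    24 / a ^+ 2 * l ^+ 2 * ((548 + (b + 2 * a) ^+ 2) * (l ^+ 4 * v)) by ring.
  by rewrite ler_wpM2l // mulr_ge0 ?divr_ge0 ?sqr_ge0.
rewrite /rate_const; set D := 2 + _.
have D0 : 0 <= D.
  apply: addr_ge0; first exact: ler0n.
  apply: mulr_ge0; first by apply: divr_ge0; [exact: ler0n | exact: sqr_ge0].
  by apply: addr_ge0; [exact: ler0n | exact: sqr_ge0].
have -> : 64 * D * (1 + ln n%:R) ^+ 6 * v = D * (64 * (1 + ln n%:R) ^+ 6 * v) by ring.
apply: ler_wpM2l => //; apply: ler_wpM2r => //.
have -> : 64 * (1 + ln n%:R) ^+ 6 = (2 * (1 + ln n%:R)) ^+ 6 :> R by ring.
apply: lerXn2r => //; rewrite nnegrE; first by rewrite (le_trans _ l1).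
by rewrite mulr_ge0 // addr_ge0 // ln_ge0.
Qed.

End Rate.

Theorem theorem3p2 (R : realType) :
  exists That : forall (n : nat) (eps : R), estimator R n,
    (forall (n : nat) (eps : R), 0 < eps ->
       private_estimator eps (That n eps)) /\
    forall (PX PY : probability R R) (fX fY : R -> R) (a b : R) (T : R -> R),
      0 < a -> a < b ->
      has_density01 PX fX -> has_density01 PY fY ->
      (forall x : R, x \in `[0, 1] -> a <= fX x <= b /\ a <= fY x <= b) ->
      optimal_transport_map PX PY T ->
      forall gamma : R, 0 < gamma ->
      exists (PolyLog : nat -> R -> R) (C : R), [/\ polylog PolyLog, 0 < C &
        forall eps : nat -> R,
          (forall n : nat, 0 < eps n) ->
          (fun n : nat => Num.min n%:R (n%:R * eps n)) @ \oo --> +oo ->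
          big_Omega_rate gamma eps ->
          \forall n \near \oo,
            forall (d : measure_display) (Omega : measurableType d)
              (Pr : probability Omega R) (X Y : 'I_n -> {RV Pr >-> R}),
              iid_two_samples X Y PX PY ->
              (L2_risk X Y (That n (eps n)) PX T <=
                (C * PolyLog n (eps n) *
                 Num.max (n%:R^-1) ((n%:R ^+ 2 * eps n ^+ 2)^-1))%:E)%E].
Proof.
exists (@laplace_estimator R); split; first by move=> n eps; exact: laplace_estimator_private.
move=> PX PY fX fY a b T a0 ab HX HY Hab optT gamma _.
have hX : bounded_density a b PX.
  by split => //; exists fX => // x /Hab[].
have hY : bounded_density a b PY.
  by split => //; exists fY => // x /Hab[].
exists (fun n _ => (1 + ln n%:R) ^+ 6), (rate_const a b); split.
(* The outer variable stands for ln n and the inner one for |ln eps|; this polynomial is constant in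
   the latter. *)
- exists ((1 + 'X) ^+ 6) => n eps n0 _; rewrite !hornerE ger0_norm //.
  by rewrite exprn_ge0 // addr_ge0 // ln_ge0 // ler1n.
- exact: rate_const_gt0.
move=> eps eps0 _ _; exists 2%N => // n /= n1 d Omega Pr X Y XY.
apply: le_trans (L2_risk_le (ltnW n1) XY hX hY (eps0 n) optT) _.
by rewrite lee_fin risk_const_le // ltW // (lt_trans a0 ab).
Qed.
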